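(* Let $r=r(n)$ satisfy $n\gg r(n)$. Denote $G_n=G(n,r,0)$, $d_n=d(G(n,r,0))$, $N_n=\binom{n}{r}$, and let $G_n(p)$ denote the random subgraph of $G_n$ with edge retention probability $p$. Then: 1. For any fixed $0<\alpha<1$, w.h.p. all components of $G_n(\frac{\alpha}{d_n})$ have size $O(\log(N_n))$. 2. For any fixed $\alpha>1$, w.h.p. there exists a component of size $(1+o(1))(1-\frac{\overline{\alpha}}{\alpha})N_n$ in $G_n(\frac{\alpha}{d_n})$, where $\overline{\alpha}$ is the solution of $xe^{-x}=\alpha e^{-\alpha}$ different from $\alpha$. At the same time, all other components of $G_n(\frac{\alpha}{d_n})$ have size $O(\log(N_n))$.
   Context: For integers $n,r,s$ (with $r\ge1$), the Johnson graph $G(n,r,s)$ has as vertices all vectors $v\in\{0,1\}^n$ with exactly $r$ ones; two vertices are joined by an edge if and only if their inner product equals $s$. It is regular; $d(G)$ denotes the vertex degree of a regular graph $G$, so $d(G(n,r,s))=\binom{r}{s}\binom{n-r}{r-s}$. For a graph $G$ and $p\in[0,1]$, $G(p)$ is the random graph obtained from $G$ by removing every edge with probability $1-p$ independently of all other edges. ''W.h.p.'' means with probability tending to $1$ as $n\to\infty$. The size of a component is its number of vertices. $f(n)\gg g(n)$ means $f(n)/g(n)\to\infty$ as $n\to\infty$. *)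

(* Defs.v *)
From HB Require Import structures.
From mathcomp Require Import all_boot all_order all_algebra.
From mathcomp Require Import all_classical all_reals all_analysis.
Import Order.TTheory GRing.Theory Num.Theory.
Import numFieldNormedType.Exports.

Set Implicit Arguments.
Unset Strict Implicit.
Unset Printing Implicit Defensive.

Local Open Scope ring_scope.

Section FiniteGraphs.
Variable T : finType.

(* A graph on T is a symmetric irreflexive relation; its edges are the
   unordered pairs [set x; y]. A spanning subgraph is given by the set F of
   its edges. *)
Definition edges (e : rel T) : {set {set T}} :=
  [set [set u.1; u.2] | u : T * T & e u.1 u.2].

Definition adj (F : {set {set T}}) : rel T := [rel x y | [set x; y] \in F].

Definition components (F : {set {set T}}) : {set {set T}} :=
  equivalence_partition (connect (adj F)) [set: T].

Definition degree (e : rel T) (x : T) : nat := #|[set y | e x y]|.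

(* On a regular graph the maximum is the common degree of all vertices. *)
Definition regular_degree (e : rel T) : nat := \max_(x : T) degree e x.

(* The probability that the random subgraph of e with independent edge
   retention probability p, identified with its edge set, satisfies A. The
   formula is a polynomial in p that is only meaningful for 0 <= p <= 1. *)
Definition prob_subgraph (R : realType) (e : rel T) (p : R)
    (A : pred {set {set T}}) : R :=
  \sum_(F : {set {set T}} | (F \subset edges e) && A F)
    p ^+ #|F| * (1 - p) ^+ #|edges e :\: F|.

End FiniteGraphs.

Definition johnson_vertex (n r : nat) : finType :=
  {v : {ffun 'I_n -> bool} | (\sum_i v i == r)%N}.

Definition johnson (n r s : nat) : rel (johnson_vertex n r) :=
  fun v w => (v != w) && (\sum_i val v i * val w i == s)%N.
Arguments johnson : clear implicits.

Lemma weightE n (v : {ffun 'I_n -> bool}) : (\sum_i v i)%N = #|[set i | v i]|.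
Proof. rewrite -sum1dep_card [RHS]big_mkcond; apply: eq_bigr => i _; by case: (v i). Qed.

Lemma card_johnson_vertex n r : #|johnson_vertex n r| = 'C(n, r).
Proof.
rewrite card_sig -[in RHS](card_ord n) -card_draws.
rewrite -(card_imset (f := fun v : {ffun 'I_n -> bool} => [set i | v i])).
  apply: eq_card => A; rewrite !inE; apply/imsetP/idP.
    by case=> v; rewrite inE => /eqP <- ->; rewrite -weightE.
  move=> /eqP hA; exists [ffun i => i \in A].
    rewrite inE weightE -hA; apply/eqP; apply: eq_card => i; by rewrite inE ffunE.
  by apply/setP => i; rewrite inE ffunE.
by move=> v w /setP h; apply/ffunP => i; have := h i; rewrite !inE.
Qed.

Lemma degree_johnson n r (v : johnson_vertex n r) : (0 < r)%N ->
  degree (johnson n r 0) v = 'C(n - r, r).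
Proof.
move=> r0; rewrite /degree.
set V := [set i | val v i].
have cV : #|V| = r by rewrite -weightE; apply/eqP/(valP v).
have cVC : #|~: V| = (n - r)%N by rewrite cardsCs finset.setCK card_ord cV.
rewrite -cVC -cards_draws.
rewrite -(card_imset (f := fun w : johnson_vertex n r => [set i | val w i])).
  apply: eq_card => A; rewrite !inE; apply/imsetP/idP.
    case=> w; rewrite inE => /andP[_ /eqP h ->].
    rewrite -weightE (valP w) andbT; apply/fintype.subsetP => i; rewrite !inE => wi.
    apply/negP => vi; move/eqP: h; rewrite sum_nat_eq0 => /forallP/(_ i).
    by rewrite vi wi.
  move=> /andP[/fintype.subsetP sA /eqP hA].
  have hf : (\sum_i [ffun i => i \in A] i == r)%N.
    by rewrite weightE -hA; apply/eqP; apply: eq_card => i; rewrite inE ffunE.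
  exists (Sub [ffun i => i \in A] hf); last first.
    by apply/setP => i; rewrite inE SubK ffunE.
  have hs : (\sum_i val v i * [ffun i => i \in A] i == 0)%N.
    rewrite sum_nat_eq0; apply/forallP => i /=; rewrite ffunE.
    case iA : (i \in A); last by rewrite muln0.
    by have := sA i iA; rewrite !inE => /negbTE ->.
  rewrite inE /johnson SubK hs andbT; apply/eqP => hv.
  move: hs; rewrite -[X in X == _]/(\sum_i val v i * [ffun i => i \in A] i)%N.
  have -> : [ffun i => i \in A] = val v by rewrite hv SubK.
  rewrite sum_nat_eq0 => /forallP h.
  have : (0 < #|V|)%N by rewrite cV.
  case/card_gt0P => i; rewrite inE => vi; by have := h i; rewrite vi.
by move=> v1 w /setP h; apply/val_inj/ffunP => i; have := h i; rewrite !inE.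
Qed.

Definition whp (R : realType) (P : nat -> R) : Prop :=
  (P n @[n --> \oo] --> (1 : R))%classic.

(* Main.v *)
Require Import Defs.
From mathcomp Require Import all_boot all_order all_algebra.
From mathcomp Require Import perm ring lra.
Import Order.TTheory GRing.Theory Num.Theory.

Set Implicit Arguments.
Unset Strict Implicit.
Unset Printing Implicit Defensive.

Local Open Scope ring_scope.

(* A d-regular graph on N vertices is pseudorandom when every vertex set S
   spans at most d |S| (|S|/N + kappa) ordered adjacent pairs, with kappa
   small. The Kneser graph G(n,r,0) is: swapping two coordinates of a vertex
   leaves all but a fraction r/(n-r) of its neighbours in place, so averaging
   over neighbours contracts the Lipschitz seminorm by kappa = r/(n-r), hence
   (by self-adjointness) also the L^2 norm of mean-zero functions.

   For a vertex set S of size k, compare the probabilities that S is a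
   component in G(p) and in G(q), where q <= p. Since S needs k-1 edges and
   has at most dk touching ones, and since a spanning tree survives thinning
   with probability (q/p)^(k-1),
     (p/q)^(k-1) ((1-p)/(1-q))^(dk) <= P_p(S) / P_q(S)
       <= (p/q)^(k-1) ((1-p)/(1-q))^(number of boundary edges of S),
   and no tree has to be counted, because the P_q(S) with v in S sum to 1.
   - q = alpha/d against p = 1/d gives exponential tails for alpha < 1.
   - p = alpha/d against q = 1/((1-x0)d), with the pseudorandom bound on the
     boundary, shows that for alpha > 1 and x0 < 1 - 1/alpha no component has
     size between C log N and x0 N.
   - p = alpha/d against the dual q = alphabar/d: both sides tend to
     alphabar/alpha for bounded k, so the fraction of vertices in bounded
     components is alphabar/alpha + o(1); it is concentrated because adding an
     edge moves a bounded number of vertices.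
   Finally alpha + alphabar > 2 lets x0 be chosen with 2 x0 > 1 -
   alphabar/alpha, so two components larger than x0 N cannot coexist. *)

(** * Random subsets *)

Section BernoulliSubsets.
Variables (R : realFieldType) (U : finType).
Implicit Types (D F A B : {set U}) (p q : R) (f g : {set U} -> R).

(** Each point of [D] is kept independently with probability [p]. This is a polynomial in [p], so
    identities hold for every [p] and only order statements ask for [0 <= p <= 1]. *)
Definition expect D p f : R :=
  \sum_(F : {set U} | F \subset D) p ^+ #|F| * (1 - p) ^+ #|D :\: F| * f F.

Lemma eq_expect D p f g : (forall F, F \subset D -> f F = g F) ->
  expect D p f = expect D p g.
Proof. by move=> fg; apply: eq_bigr => F /fg ->. Qed.

Lemma expect_set0 p f : expect set0 p f = f set0.
Proof.
rewrite /expect (big_pred1 set0) => [|F]; last by rewrite subset0.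
by rewrite setD0 cards0 !expr0 !mul1r.
Qed.

(** Conditioning on whether [x] is kept. The inductions on the ground set below all run through this
    recursion. *)
Lemma expect_setU1 D p f x : x \notin D ->
  expect (x |: D) p f =
  p * expect D p (fun F => f (x |: F)) + (1 - p) * expect D p f.
Proof.
move=> xD; rewrite /expect (bigID (fun F : {set U} => x \in F)) /=; congr (_ + _).
  rewrite (reindex_onto (fun F => x |: F) (fun F => F :\ x)) /=; last first.
    by move=> F /andP[_ xF]; rewrite setD1K.
  rewrite mulr_sumr; apply: eq_big => [F|F].
    rewrite setU11 andbT; apply/andP/idP => [[h /eqP <-]|h].
      by rewrite subDset.
    rewrite setUS // setU1K //.
    by apply: contra xD; apply: (subsetP h).
  move=> /andP[/andP[h _] /eqP h2].
  have xF : x \notin F by rewrite -h2 !inE eqxx.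
  have -> : (x |: D) :\: (x |: F) = D :\: F.
    apply/setP => y; rewrite !inE; case: eqP => [->|] //=.
    by rewrite xF (negbTE xD).
  by rewrite cardsU1 xF exprS !mulrA.
rewrite mulr_sumr; apply: eq_big => [F|F /andP[h xF]].
  apply/andP/idP => [[h xF]|h].
    apply/subsetP => y yF; have := subsetP h _ yF.
    by rewrite !inE => /predU1P[yx|//]; rewrite -yx yF in xF.
  split; first by apply: subset_trans h _; apply: subsetUr.
  by apply: contra xD; apply: (subsetP h).
have -> : (x |: D) :\: F = x |: (D :\: F).
  by apply/setP => y; rewrite !inE; case: eqP => [->|] //=; rewrite xF.
by rewrite cardsU1 !inE (negbTE xD) andbF exprS; ring.
Qed.

Lemma set_ind1 (P : {set U} -> Prop) : P set0 ->
  (forall x D, x \notin D -> P D -> P (x |: D)) -> forall D, P D.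
Proof.
move=> P0 PS D; move: {2}#|D| (erefl #|D|) => n; elim: n D => [|n IH] D cD.
  by move/eqP: cD; rewrite cards_eq0 => /eqP ->.
have /card_gt0P[x xD] : (0 < #|D|)%N by rewrite cD.
rewrite -(setD1K xD); apply: PS; first by rewrite !inE eqxx.
by apply: IH; move: cD; rewrite (cardsD1 x) xD => -[].
Qed.

Lemma expectD D p f g :
  expect D p (fun F => f F + g F) = expect D p f + expect D p g.
Proof. by rewrite -big_split; apply: eq_bigr => F _; rewrite mulrDr. Qed.

Lemma expectZ D p c f : expect D p (fun F => c * f F) = c * expect D p f.
Proof. by rewrite mulr_sumr; apply: eq_bigr => F _; rewrite mulrCA. Qed.

Lemma expect_sum D p (I : Type) (s : seq I) (P : pred I) (f : I -> {set U} -> R) :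
  expect D p (fun F => \sum_(i <- s | P i) f i F) = \sum_(i <- s | P i) expect D p (f i).
Proof.
by rewrite exchange_big /=; apply: eq_bigr => F _; rewrite mulr_sumr.
Qed.

Lemma expect_cst D p c : expect D p (fun=> c) = c.
Proof.
elim/set_ind1: D => [|x D xD IH]; first by rewrite expect_set0.
by rewrite expect_setU1 // IH; ring.
Qed.

Lemma le_expect D p f g : 0 <= p <= 1 ->
  (forall F, F \subset D -> f F <= g F) -> expect D p f <= expect D p g.
Proof.
move=> /andP[p0 p1] fg; apply: ler_sum => F FD.
by rewrite ler_wpM2l ?fg // mulr_ge0 ?exprn_ge0 ?subr_ge0.
Qed.

Lemma expect_ge0 D p f : 0 <= p <= 1 ->
  (forall F, F \subset D -> 0 <= f F) -> 0 <= expect D p f.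
Proof. by move=> p01 f0; rewrite -(expect_cst D p 0); apply: le_expect. Qed.

Lemma expect_setU A B p f : [disjoint A & B] ->
  expect (A :|: B) p f =
  expect A p (fun F => expect B p (fun H => f (F :|: H))).
Proof.
elim/set_ind1: A f => [|x A xA IH] f.
  by rewrite set0U expect_set0 => _; apply: eq_expect => F _; rewrite set0U.
rewrite disjoints_subset subUset sub1set !inE -disjoints_subset => /andP[xB dAB].
rewrite -setUA !expect_setU1 ?IH ?inE ?negb_or ?xA //.
congr (_ * _ + _); apply: eq_expect => F _; apply: eq_expect => H _.
by rewrite setUA.
Qed.

(** Two-stage exposure: a point kept with probability [p] and then again with probability [q]
    survives with probability [p * q], independently of the others. *)
Lemma expect_thin D p q f :
  expect D (p * q) f = expect D p (fun F => expect F q f).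
Proof.
elim/set_ind1: D f => [|x D xD IH] f; first by rewrite !expect_set0.
rewrite !expect_setU1 // !IH.
rewrite [in RHS](@eq_expect D p _ (fun F => q * expect F q (fun F => f (x |: F)) +
  (1 - q) * expect F q f)); last first.
  move=> F FD; rewrite expect_setU1 //.
  by apply: contra xD; apply: (subsetP FD).
by rewrite expectD !expectZ; ring.
Qed.

(** Split [D] into [A] and the rest, and retain only the outcome in which all of [A] is kept. The
    function [f] stands for the indicator of an event that this outcome forces. *)
Lemma expect_supset A D p f : A \subset D -> 0 <= p <= 1 ->
  (forall F, F \subset D -> 0 <= f F) ->
  (forall F, A \subset F -> F \subset D -> 1 <= f F) -> p ^+ #|A| <= expect D p f.
Proof.
move=> AD p01 f0 f1; have /andP[p0 p1] := p01.
have -> : D = A :|: (D :\: A).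
  by apply/setP => x; rewrite !inE; have := subsetP AD x; case: (x \in A) => //= ->.
rewrite expect_setU; last first.
  by rewrite disjoints_subset; apply/subsetP => x; rewrite !inE => ->.
rewrite /expect (bigD1 A) //= setDv cards0 expr0 mulr1 -[leLHS]addr0; apply: lerD.
  rewrite ler_peMr ?exprn_ge0 // -[leLHS](expect_cst (D :\: A) p 1).
  apply: le_expect => // F FD; apply: f1; first exact: subsetUl.
  by rewrite subUset AD (subset_trans FD) ?subsetDl.
apply: sumr_ge0 => F /andP[FA _]; apply: mulr_ge0.
  by rewrite mulr_ge0 ?exprn_ge0 ?subr_ge0.
apply: expect_ge0 => // H HD; apply: f0.
by rewrite subUset (subset_trans FA) // (subset_trans HD) ?subsetDl.
Qed.

Lemma expect_disjoint A D p : A \subset D ->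
  expect D p (fun F => [disjoint F & A]%:R) = (1 - p) ^+ #|A|.
Proof.
elim/set_ind1: A D => [|x A xA IH] D.
  rewrite cards0 expr0 -[RHS](expect_cst D p 1) => _; apply: eq_expect => F _.
  by rewrite disjoints_subset setC0 subsetT.
rewrite subUset sub1set => /andP[xD AD].
have AD1 : A \subset D :\ x by rewrite subsetD1 AD.
rewrite -(setD1K xD) expect_setU1 ?inE ?eqxx // cardsU1 xA exprS -(IH _ AD1).
rewrite (@eq_expect (D :\ x) p (fun F => [disjoint x |: F & x |: A]%:R) (fun=> 0)); last first.
  by move=> F _; rewrite -setI_eq0; case: eqP => // /setP/(_ x); rewrite !inE eqxx.
rewrite expect_cst mulr0 add0r; congr (_ * _); apply: eq_expect => F FD.
congr ((_ : bool)%:R); rewrite ![[disjoint F & _]]disjoint_sym !disjoints_subset.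
rewrite subUset sub1set inE; case xF : (x \in F) => //.
by have := subsetP FD _ xF; rewrite !inE eqxx.
Qed.

(* Efron-Stein for bounded differences: exposing the points one by one, each
   contributes at most p M^2. *)
Lemma expect_variance D p f (M : R) : 0 <= p <= 1 ->
  (forall F x, x \in D -> F \subset D -> `|f (x |: F) - f F| <= M) ->
  expect D p (fun F => f F ^+ 2) - expect D p f ^+ 2 <= #|D|%:R * p * M ^+ 2.
Proof.
move=> p01; have /andP[p0 p1] := p01.
elim/set_ind1: D f => [|x D xD IH] f hf; first by rewrite !expect_set0 subrr cards0 !mul0r.
have sub F : F \subset D -> F \subset x |: D.
  by move=> h; apply: subset_trans h _; apply: subsetUr.
have h0 := IH f (fun F y yD FD => hf F y (setU1r _ yD) (sub _ FD)).
have h1 : expect D p (fun F => f (x |: F) ^+ 2) - expect D p (fun F => f (x |: F)) ^+ 2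
    <= #|D|%:R * p * M ^+ 2.
  apply: (IH (fun F => f (x |: F))) => F y yD FD.
  by rewrite setUCA; apply: hf; [exact: setU1r|exact: setUS].
have hd : (expect D p (fun F => f (x |: F)) - expect D p f) ^+ 2 <= M ^+ 2.
  rewrite -real_normK ?num_real // lerXn2r ?nnegrE //.
    by apply: le_trans (hf set0 x _ _); rewrite ?setU11 ?sub0set.
  rewrite -mulN1r -expectZ -expectD ler_norml; apply/andP; split.
    rewrite -(expect_cst D p (- M)); apply: le_expect => // F FD.
    by have := hf F x (setU11 _ _) (sub _ FD); rewrite ler_norml => /andP[]; lra.
  rewrite -[leRHS](expect_cst D p M); apply: le_expect => // F FD.
  by have := hf F x (setU11 _ _) (sub _ FD); rewrite ler_norml => /andP[]; lra.
rewrite !expect_setU1 // cardsU1 xD natrD.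
move: h0 h1 hd; set a1 := expect D p _; set a0 := expect D p _.
set b1 := expect D p _; set b0 := expect D p _; set V := _ * M ^+ 2 => h0 h1 hd.
have -> : (true%:R + #|D|%:R) * p * M ^+ 2 = V + p * M ^+ 2 by rewrite /V /=; ring.
have h2 : p * (1 - p) * (b0 - a0) ^+ 2 <= p * M ^+ 2.
  by rewrite -mulrA ler_wpM2l //; apply: le_trans hd; rewrite ler_piMl ?sqr_ge0 //; lra.
have h3 : (1 - p) * (a1 - a0 ^+ 2) <= (1 - p) * V by rewrite ler_wpM2l ?subr_ge0.
have h4 : p * (b1 - b0 ^+ 2) <= p * V by rewrite ler_wpM2l.
(* Law of total variance over the choice of [x]: [a0], [a1] are the first and second moments without
   [x], and [b0], [b1] those with [x]. *)
apply: le_trans (_ : (1 - p) * (a1 - a0 ^+ 2) + p * (b1 - b0 ^+ 2)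
  + p * (1 - p) * (b0 - a0) ^+ 2 <= _); last by lra.
by rewrite le_eqVlt; apply/orP; left; apply/eqP; ring.
Qed.

Lemma expect_markov D p f (t : R) : 0 <= p <= 1 -> 0 < t ->
  (forall F, F \subset D -> 0 <= f F) ->
  expect D p (fun F => (t <= f F)%R%:R) <= expect D p f / t.
Proof.
move=> p01 t0 f0; rewrite mulrC -expectZ; apply: le_expect => // F FD.
case: (leP t) => h /=; last by rewrite mulr_ge0 ?f0 ?invr_ge0 // ltW.
by rewrite mulrC ler_pdivlMr // mul1r.
Qed.

Lemma expect_chebyshev D p f (M t : R) : 0 <= p <= 1 -> 0 < t ->
  (forall F x, x \in D -> F \subset D -> `|f (x |: F) - f F| <= M) ->
  expect D p (fun F => (t <= `|f F - expect D p f|)%R%:R)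
    <= #|D|%:R * p * M ^+ 2 / t ^+ 2.
Proof.
move=> p01 t0 hf; set m := expect D p f.
apply: (@le_trans _ _ (expect D p (fun F => (f F - m) ^+ 2) / t ^+ 2)).
  apply: (@le_trans _ _ (expect D p (fun F => (t ^+ 2 <= (f F - m) ^+ 2)%R%:R))).
    apply: le_expect => // F _.
    rewrite -(real_normK (num_real (f F - m))) ler_pXn2r ?lexx ?nnegrE ?normr_ge0 //.
    exact: ltW.
  by apply: expect_markov => // [|F _]; rewrite ?exprn_gt0 ?sqr_ge0.
rewrite ler_pM2r ?invr_gt0 ?exprn_gt0 //; apply: le_trans (expect_variance p01 hf).
rewrite (@eq_expect _ _ _ (fun F => f F ^+ 2 + ((- 2 * m) * f F + m ^+ 2))); last first.
  by move=> F _; ring.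
by rewrite !expectD expectZ expect_cst -/m; lra.
Qed.

End BernoulliSubsets.

(** * Components of random subgraphs *)

Section RandomSubgraph.
Variables (T : finType) (e : rel T).
Implicit Types (F : {set {set T}}) (S A : {set T}) (v w x y : T).

Definition component F v : {set T} := [set w | connect (adj F) v w].

Lemma adj_connect_sym F : connect_sym (adj F).
Proof. by apply: sym_connect_sym => x y; rewrite /adj /= setUC. Qed.

Lemma component_self F v : v \in component F v.
Proof. by rewrite inE connect0. Qed.

Lemma component_eq F v w : w \in component F v -> component F w = component F v.
Proof.
rewrite inE => vw; apply/setP => x; rewrite !inE.
by rewrite (same_connect (@adj_connect_sym F) vw).
Qed.

Lemma componentsP F S :
  reflect (exists v, S = component F v) (S \in components F).
Proof.
rewrite /components /equivalence_partition; apply: (iffP imsetP).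
  by case=> v _ ->; exists v; apply/setP => w; rewrite !inE.
by case=> v ->; exists v; rewrite ?inE //; apply/setP => w; rewrite !inE.
Qed.

Lemma component_step F v x y : x \in component F v -> [set x; y] \in F -> y \in component F v.
Proof.
by rewrite !inE => vx xy; apply: connect_trans vx _; apply: connect1.
Qed.

Lemma component_sub F v A : v \in A ->
  (forall x y, x \in A -> [set x; y] \in F -> y \in A) -> component F v \subset A.
Proof.
move=> vA hA; apply/subsetP => w; rewrite inE => vw.
have cl : closed (adj F) (mem A).
  by apply: (intro_closed (@adj_connect_sym F)) => x y xy xA; apply: hA xy.
by rewrite -(closed_connect cl vw).
Qed.

Lemma component_mono F F' v : F \subset F' -> component F v \subset component F' v.
Proof.
move=> FF'; apply: component_sub (component_self _ _) _ => x y xA xy.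
by apply: component_step xA _; apply: (subsetP FF').
Qed.

(** Grow a tree from [v] edge by edge: as long as [U] is smaller than the component, some edge of
    [F] leaves [U]. Keeping the edges of [H] inside [U] guarantees that the next edge is new. *)
Lemma spanning_tree_aux F v n : (n < #|component F v|)%N ->
  exists (U : {set T}) (H : {set {set T}}),
  [/\ v \in U, U \subset component F v, #|U| = n.+1, H \subset F &
   [/\ #|H| = n, U \subset component H v & forall f, f \in H -> f \subset U]].
Proof.
elim: n => [_|n IH hn].
  exists [set v], set0; rewrite set11 !sub1set !component_self cards1 sub0set cards0.
  by split=> //; split=> // f; rewrite inE.
have [U [H [vU US cU HF [cH UH hU]]]] := IH (ltnW hn).
have [x [y [xU yU xy]]] : exists x y, [/\ x \in U, y \notin U & [set x; y] \in F].
  have [/existsP[x /existsP[y /and3P[]]]|no] :=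
    boolP [exists x, exists y, [&& x \in U, y \notin U & [set x; y] \in F]].
    by exists x, y.
  suff: component F v \subset U by move/subset_leq_card; rewrite cU leqNgt hn.
  apply: component_sub => // x y xU xy; apply: contraNT no => yU.
  by apply/existsP; exists x; apply/existsP; exists y; rewrite xU yU.
have xyH : [set x; y] \notin H.
  by apply: contra yU => /hU /subsetP; apply; rewrite !inE eqxx orbT.
have sU : U \subset y |: U by apply: subsetUr.
have sH : H \subset [set x; y] |: H by apply: subsetUr.
have yC : y \in component ([set x; y] |: H) v.
  apply: (@component_step _ _ x); last by rewrite setU11.
  by apply: (subsetP (component_mono v sH)); apply: (subsetP UH).
exists (y |: U), ([set x; y] |: H); rewrite !cardsU1 yU xyH cU cH.
split=> //; first by rewrite inE vU orbT.
- by rewrite subUset US sub1set andbT; apply: component_step xy; apply: (subsetP US).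
- by rewrite subUset HF sub1set xy.
split=> //; first by rewrite subUset sub1set yC; apply: subset_trans UH (component_mono v sH).
move=> f; rewrite !inE => /predU1P[->|/hU fU]; last exact: subset_trans fU sU.
by rewrite subUset !sub1set !inE xU eqxx orbT.
Qed.

Lemma spanning_tree F v : exists H : {set {set T}},
  [/\ H \subset F, #|H| = #|component F v|.-1 & component H v = component F v].
Proof.
have c0 : (0 < #|component F v|)%N by apply/card_gt0P; exists v; apply: component_self.
have [|U [H [vU US cU HF [cH UH hU]]]] := @spanning_tree_aux F v #|component F v|.-1.
  by rewrite prednK.
exists H; split=> //; apply/eqP; rewrite eqEsubset component_mono //=.
by rewrite -(_ : U = component F v) //; apply/eqP; rewrite eqEcard US cU prednK /=.
Qed.

Definition inner_edges S := [set f in edges e | f \subset S].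
Definition boundary S :=
  [set f in edges e | ~~ (f \subset S) && ~~ [disjoint f & S]].

Lemma inner_sub S : inner_edges S \subset edges e.
Proof. by apply/subsetP => f; rewrite inE => /andP[]. Qed.

Lemma boundary_sub S : boundary S \subset edges e :\: inner_edges S.
Proof. by apply/subsetP => f; rewrite !inE => /and3P[-> /negbTE-> _]. Qed.

Lemma edgesP f : reflect (exists x y, e x y /\ f = [set x; y]) (f \in edges e).
Proof.
apply: (iffP imsetP) => [[[x y] h ->]|[x [y [xy ->]]]].
  by exists x, y; rewrite inE in h.
by exists (x, y); rewrite ?inE.
Qed.

(** A present boundary edge would enlarge the component beyond [S], and without one no path from [v]
    leaves [S]. The event thus splits into conditions on two disjoint edge sets. *)
Lemma component_local F S v : F \subset edges e -> v \in S ->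
  (component F v == S) = [disjoint F & boundary S] && (component (F :&: inner_edges S) v == S).
Proof.
move=> Fe vS; apply/eqP/andP => [hS|[dF /eqP hS]].
  split.
    rewrite disjoint_subset; apply/subsetP => f fF; rewrite inE; apply/negP.
    rewrite inE => /and3P[/edgesP[x [y [xy fxy]]]]; subst f.
    case/subsetPn => z; rewrite inE => hz zS; case/pred0Pn => t /andP[/=]; rewrite inE => ht tS.
    have zt : z != t by apply: contraNneq zS => ->.
    case/negP: zS; rewrite -hS; apply: (@component_step _ _ t); first by rewrite hS.
    have -> // : [set t; z] = [set x; y].
    by move: hz ht zt; rewrite !inE => /orP[]/eqP-> /orP[]/eqP->; rewrite ?eqxx // setUC.
  have sF := component_mono v (subsetIl F (inner_edges S)).
  rewrite hS in sF; rewrite eqEsubset sF /=.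
  suff: component F v \subset component (F :&: inner_edges S) v by rewrite hS.
  apply: component_sub (component_self _ _) _ => x y xA xy; have xS : x \in S by apply: (subsetP sF).
  apply: component_step xA _.
  rewrite !inE xy (subsetP Fe) //= subUset !sub1set xS -hS.
  by apply: component_step xy; rewrite hS.
apply/eqP; rewrite eqEsubset -{2}hS component_mono ?subsetIl // andbT.
apply: component_sub => // x y xS xy; apply: contraTT dF => yS.
apply/pred0Pn; exists [set x; y] => /=; rewrite xy !inE (subsetP Fe) //=.
rewrite subUset !sub1set (negbTE yS) andbF /=.
by apply/pred0Pn; exists x; rewrite /= !inE eqxx.
Qed.

(** * Probability that a given set is a component *)

Section Density.
Variable R : realFieldType.
Implicit Types p q : R.

Definition prob_component p v S : R :=
  expect (edges e) p (fun F => (component F v == S)%:R).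

(** Boundary and inner edges are disjoint, hence independent; the boundary contributes an exact
    power and the edges avoiding [S] integrate out. *)
Lemma prob_component_inner p v S : v \in S -> prob_component p v S =
  (1 - p) ^+ #|boundary S| * expect (inner_edges S) p (fun F => (component F v == S)%:R).
Proof.
move=> vS; have eE : edges e = inner_edges S :|: (edges e :\: inner_edges S).
  by apply/setP => f; rewrite !inE; case: (f \in edges e); rewrite ?andbF //= andbT orbN.
rewrite /prob_component [in LHS]eE expect_setU; last first.
  by rewrite disjoint_sym disjoints_subset; apply/subsetP => f; rewrite !inE => /andP[->].
rewrite -expectZ; apply: eq_expect => F FI.
rewrite -(expect_disjoint p (boundary_sub S)) [RHS]mulrC -expectZ.
apply: eq_expect => H HB.
have HI : H :&: inner_edges S = set0.
  apply/setP => f; rewrite [in RHS]inE in_setI; apply/andP => -[fH fI].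
  by have := subsetP HB f fH; rewrite in_setD fI.
have FB : [disjoint F & boundary S].
  rewrite disjoints_subset; apply/subsetP => f /(subsetP FI).
  by rewrite !inE => /andP[-> ->].
rewrite component_local //; last first.
  rewrite subUset (subset_trans FI (inner_sub S)) (subset_trans HB) ?subsetDl //.
rewrite setIUl HI setU0 (setIidPl FI) -!setI_eq0 setIUl.
move: FB; rewrite -setI_eq0 => /eqP ->; rewrite set0U.
by case: eqP; rewrite ?mulr1 ?mulr0.
Qed.

(** Compare one inner edge set [F] at a time. If [F] connects [S], it has at least [#|S|.-1] edges,
    each gaining [p / q >= 1]; absent inner edges cost [(1 - p) / (1 - q) <= 1] each, a cost charged
    here to all inner edges. *)
Lemma prob_component_ge p q v S : 0 < q <= p -> p < 1 -> v \in S ->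
  (p / q) ^+ #|S|.-1 * ((1 - p) / (1 - q)) ^+ (#|inner_edges S| + #|boundary S|)
    * prob_component q v S <= prob_component p v S.
Proof.
move=> /andP[q0 qp] p1 vS; rewrite !prob_component_inner // exprD.
have p0 := lt_le_trans q0 qp; have q1 := le_lt_trans qp p1.
have p1' : 0 < 1 - p by rewrite subr_gt0.
have q1' : 0 < 1 - q by rewrite subr_gt0.
have mulE (x1 x2 x3 x4 x5 : R) : x1 * (x2 * x3) * (x4 * x5) = x3 * x4 * (x1 * x2 * x5).
  by ring.
set c : R := (1 - p) / (1 - q); set b := #|boundary S|; set I := inner_edges S.
have c0 : 0 < c by rewrite divr_gt0.
have -> : (1 - p) ^+ b = c ^+ b * (1 - q) ^+ b.
  by rewrite -exprMn /c divfK // gt_eqF.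
set Eq := expect I q _; set Ep := expect I p _.
suff h : (p / q) ^+ #|S|.-1 * c ^+ #|I| * Eq <= Ep.
  have cb0 : 0 <= c ^+ b * (1 - q) ^+ b by rewrite mulr_ge0 ?exprn_ge0 ?ltW.
  by rewrite mulE ler_wpM2l.
rewrite /Eq /Ep -expectZ; apply: ler_sum => F FI.
have [hS|_] := eqVneq (component F v) S; last by rewrite !mulr0.
rewrite !mulr1 mulrC; have [H [HF cH _]] := spanning_tree F v.
have kF : (#|S|.-1 <= #|F|)%N by rewrite -hS -cH subset_leq_card.
have -> : p ^+ #|F| = (p / q) ^+ #|F| * q ^+ #|F|.
  by rewrite -exprMn divfK // gt_eqF.
have -> : (1 - p) ^+ #|I :\: F| = c ^+ #|I :\: F| * (1 - q) ^+ #|I :\: F|.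
  by rewrite -exprMn /c divfK // gt_eqF.
have h1 : (p / q) ^+ #|S|.-1 <= (p / q) ^+ #|F|.
  by rewrite ler_weXn2l // ler_pdivlMr // mul1r.
have h2 : c ^+ #|I| <= c ^+ #|I :\: F|.
  rewrite ler_wiXn2l ?subset_leq_card ?subsetDl ?(ltW c0) //.
  by rewrite ler_pdivrMr // mul1r lerD2l lerN2.
have h3 : 0 <= q ^+ #|F| * (1 - q) ^+ #|I :\: F| by rewrite mulr_ge0 ?exprn_ge0 ?ltW.
rewrite [leRHS]mulrACA ler_wpM2r // ler_pM ?exprn_ge0 ?divr_ge0 ?(ltW p0) ?(ltW q0) ?(ltW c0) ?(ltW p1') ?(ltW q1') //.
Qed.

(* Thinning G(p) to G(q) keeps a given spanning tree with probability
   (q/p)^(|S|-1). *)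
Lemma prob_component_le p q v S : 0 < q <= p -> p < 1 -> v \in S ->
  prob_component p v S <=
  (p / q) ^+ #|S|.-1 * ((1 - p) / (1 - q)) ^+ #|boundary S| * prob_component q v S.
Proof.
move=> /andP[q0 qp] p1 vS; rewrite !prob_component_inner //.
have p0 := lt_le_trans q0 qp; have q1 := le_lt_trans qp p1.
have p1' : 0 < 1 - p by rewrite subr_gt0.
have q1' : 0 < 1 - q by rewrite subr_gt0.
have mulE (x1 x3 x4 x5 : R) : x3 * x4 * (x1 * x5) = x1 * x3 * (x4 * x5).
  by ring.
set c : R := (1 - p) / (1 - q); set b := #|boundary S|; set I := inner_edges S.
have c0 : 0 < c by rewrite divr_gt0.
have -> : (1 - p) ^+ b = c ^+ b * (1 - q) ^+ b.
  by rewrite -exprMn /c divfK // gt_eqF.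
set Eq := expect I q _; set Ep := expect I p _.
suff h : Ep <= (p / q) ^+ #|S|.-1 * Eq.
  have cb0 : 0 <= c ^+ b * (1 - q) ^+ b by rewrite mulr_ge0 ?exprn_ge0 ?ltW.
  by rewrite -mulE ?ler_wpM2l.
rewrite -[p / q]invrK invf_div exprVn ler_pdivlMl ?exprn_gt0 ?divr_gt0 //.
(* Writing [q] as [p * (q / p)] exhibits the subgraph at [q] as a thinning of the one at [p]. *)
rewrite /Eq /Ep -{2}(divfK (lt0r_neq0 p0) q) mulrC mulrC [q / p * p]mulrC expect_thin -expectZ.
apply: le_expect => [|F FI]; first by rewrite !ltW.
have qp01 : 0 <= q / p <= 1.
  by rewrite divr_ge0 ?(ltW p0) ?(ltW q0) //= ler_pdivrMr // mul1r.
have [hS|_] := eqVneq (component F v) S; last first.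
  by rewrite mulr0; apply: expect_ge0.
rewrite mulr1; have [H [HF cH hH]] := spanning_tree F v.
rewrite -hS -cH; apply: expect_supset => // F' HF' F'F.
rewrite (_ : component F' v = component F v) ?eqxx //.
by apply/eqP; rewrite eqEsubset component_mono //= -hH component_mono.
Qed.

End Density.

Hypothesis e_sym : symmetric e.

Lemma sum_card_pairs S (Q : rel T) :
  (\sum_(x in S) #|[set y | Q x y]| = #|[set u : T * T | (u.1 \in S) && Q u.1 u.2]|)%N.
Proof.
rewrite -sum1dep_card -(pair_big_dep (fun x => x \in S) Q (fun _ _ => 1%N)) /=.
by apply: eq_bigr => x _; rewrite sum1dep_card.
Qed.

(** A boundary edge determines its endpoint in [S], so ordered pairs leaving [S] inject into
    boundary edges. *)
Lemma card_boundary S :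
  (\sum_(x in S) #|[set y | e x y && (y \notin S)]| <= #|boundary S|)%N.
Proof.
rewrite (sum_card_pairs S (fun x y => e x y && (y \notin S))).
rewrite -(card_in_imset (f := fun u : T * T => [set u.1; u.2])).
  apply/subset_leq_card/subsetP => f /imsetP[[x y]]; rewrite inE /= => /and3P[xS xy yS] ->.
  rewrite !inE subUset !sub1set (negbTE yS) andbF /=; apply/andP; split.
    by apply/edgesP; exists x, y.
  by apply/pred0Pn; exists x; rewrite /= !inE eqxx.
move=> [x y] [x' y']; rewrite !inE /= => /and3P[xS xy yS] /and3P[xS' xy' yS'] /setP h.
have := h x; have := h y; rewrite !inE !eqxx orbT /= => /esym h1 /esym h2.
move: h1 h2 => /orP[/eqP h1|/eqP ->]; first by rewrite h1 xS' in yS.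
by move=> /orP[/eqP -> //|/eqP h2]; rewrite h2 (negbTE yS') in xS.
Qed.

Section Regular.
Variable d : nat.
Hypothesis reg : forall x, degree e x = d.

(** Every inner or boundary edge has an endpoint in [S], so it arises from one of the [#|S| * d]
    adjacent pairs that start in [S]. *)
Lemma card_touching S : (#|inner_edges S| + #|boundary S| <= #|S| * d)%N.
Proof.
rewrite -cardsUI (_ : inner_edges S :&: boundary S = set0) ?cards0 ?addn0; last first.
  by apply/setP => f; rewrite !inE; case: (f \subset S); rewrite ?andbF.
have -> : (#|S| * d = \sum_(x in S) #|[set y | e x y]|)%N.
  by rewrite -sum_nat_const; apply: eq_bigr => x _; rewrite -(reg x).
rewrite sum_card_pairs.
apply: leq_trans (leq_imset_card (fun u : T * T => [set u.1; u.2]) _).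
apply/subset_leq_card/subsetP => f.
move=> hf; suff [x [y [xS xy ->]]] : exists x y, [/\ x \in S, e x y & f = [set x; y]].
  by apply/imsetP; exists (x, y); rewrite ?inE /= ?xS.
have /edgesP[x [y [xy fxy]]] : f \in edges e.
  by move: hf; rewrite !inE => /orP[]/andP[].
have : (x \in S) || (y \in S).
  move: hf; rewrite fxy !inE subUset !sub1set.
  case/orP => [/andP[_ /andP[-> //]]|/and3P[_ _ /pred0Pn[z /= /andP[]]]].
  by rewrite !inE => /orP[]/eqP -> ->; rewrite ?orbT.
by case/orP => hS; [exists x, y|exists y, x; rewrite e_sym setUC].
Qed.

Lemma card_edges : (#|edges e| <= #|T| * d)%N.
Proof.
rewrite -cardsT; apply: leq_trans (card_touching setT).
by apply: leq_trans (leq_addr _ _); apply/subset_leq_card/subsetP => f; rewrite inE subsetT andbT.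
Qed.

Lemma card_boundary_ge S : (#|S| * d <= #|boundary S| + \sum_(x in S) #|[set y in S | e x y]|)%N.
Proof.
apply: leq_trans (leq_add (card_boundary S) (leqnn _)).
rewrite -big_split -sum_nat_const; apply: leq_sum => x _ /=.
rewrite -(reg x) /degree -(cardsID S) addnC; apply: leq_add; apply/subset_leq_card/subsetP => y.
  by rewrite !inE andbC.
by rewrite !inE andbC.
Qed.

End Regular.

Definition nb_small (K : nat) F : nat := #|[set v | (#|component F v| < K)%N]|.

Lemma component_add_edge F x y v : v \notin component F x -> v \notin component F y ->
  component ([set x; y] |: F) v = component F v.
Proof.
move=> vx vy; apply/eqP; rewrite eqEsubset [X in _ && X]component_mono ?subsetUr // andbT.
apply: component_sub (component_self _ _) _ => a b aC; rewrite in_setU1 => /predU1P[ab|]; last first.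
  exact: component_step.
have : a \in [set x; y] by rewrite -ab !inE eqxx.
have va : v \in component F a by rewrite (component_eq aC) component_self.
by rewrite !inE => /orP[]/eqP ea; rewrite -ea va in vx vy.
Qed.

(** Only vertices in the old components of [x] and [y] can change class, and each of these
    components holds at most [K] vertices counted by [nb_small]. This is the bounded difference
    behind the concentration of [nb_small]. *)
Lemma nb_small_add_edge K F x y :
  (nb_small K ([set x; y] |: F) <= nb_small K F <= nb_small K ([set x; y] |: F) + 2 * K)%N.
Proof.
set F' := _ |: F; rewrite /nb_small; apply/andP; split.
  apply/subset_leq_card/subsetP => v; rewrite !inE; apply: leq_ltn_trans.
  by apply/subset_leq_card/component_mono/subsetUr.
set W := [set v | _ < K]%N; set W' := [set v | _ < K]%N.
have small z : (#|component F z :&: W| <= K)%N.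
  have [->|[v]] := set_0Vmem (component F z :&: W); first by rewrite cards0.
  rewrite in_setI => /andP[vz]; rewrite inE => vK; apply: leq_trans (ltnW vK).
  by rewrite (component_eq vz) subset_leq_card // subsetIl.
apply: (@leq_trans #|W' :|: ((component F x :&: W) :|: (component F y :&: W))|).
  apply/subset_leq_card/subsetP => v vW; rewrite !in_setU !in_setI vW !andbT.
  case: (boolP (v \in component F x)) => vx; rewrite ?orbT //.
  case: (boolP (v \in component F y)) => vy; rewrite ?orbT // orbF.
  by rewrite orbF inE component_add_edge //; move: vW; rewrite inE.
apply: leq_trans (leq_card_setU _ _) _; rewrite leq_add2l mul2n -addnn.
by apply: leq_trans (leq_card_setU _ _) _; apply: leq_add.
Qed.

(** Splitting by the value of the component turns an event about its size into a sum over sets, to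
    which comparisons set by set apply. *)
Lemma expect_component (R : realFieldType) (p : R) v (Q : pred nat) :
  expect (edges e) p (fun F => (Q #|component F v|)%:R) =
  \sum_(S : {set T} | (v \in S) && Q #|S|) prob_component p v S.
Proof.
rewrite /prob_component -expect_sum; apply: eq_expect => F _.
case: (boolP (Q _)) => hQ.
  rewrite (bigD1 (component F v)) /= ?component_self // eqxx big1 ?addr0 // => S /andP[_].
  by rewrite eq_sym => /negbTE ->.
rewrite big1 // => S /andP[_ QS]; case: eqP => // hS.
by rewrite hS QS in hQ.
Qed.

(** Two disjoint components above [m] would put more than [2 * m] vertices into [big]. So [big] is a
    single component, and the gap pushes all others down to [t]. *)
Lemma unique_large_component (R : realFieldType) (t m : R) F :
  (forall v, ~~ (t < #|component F v|%:R <= m)) ->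
  let big := [set v | m < #|component F v|%:R] in
  (0 < #|big|)%N -> #|big|%:R <= 2 * m ->
  big \in components F /\
  forall S, S \in components F -> S != big -> #|S|%:R <= t.
Proof.
move=> gap big /card_gt0P[v vbig] hbig.
have big_comp w : w \in big -> component F w \subset big.
  move=> wb; apply/subsetP => u uw; move: wb; rewrite !inE.
  by rewrite (component_eq uw).
have bigE w : w \in big -> big = component F w.
  move=> wb; apply/eqP; rewrite eqEsubset big_comp // andbT; apply/subsetP => u ub.
  apply: contraLR hbig => uw; rewrite -ltNge.
  have dis : [disjoint component F u & component F w].
    apply/pred0P => z /=; apply/negP => /andP[zu zw]; case/negP: uw.
    by rewrite -(component_eq zw) (component_eq zu) component_self.
  have : (#|component F u| + #|component F w| <= #|big|)%N.
    rewrite -cardsUI (_ : _ :&: _ = set0) ?cards0 ?addn0; last by apply/eqP; rewrite setI_eq0.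
    by apply: subset_leq_card; rewrite subUset !big_comp.
  rewrite -(ler_nat R) natrD => /(lt_le_trans _); apply.
  by move: ub wb; rewrite !inE => h1 h2; rewrite mulr_natl mulr2n ltrD.
split; first by apply/componentsP; exists v; rewrite -(bigE v vbig).
move=> S /componentsP[w ->] wbig; have := gap w.
rewrite negb_and -leNgt -ltNge => /orP[//|mw]; case/eqP: wbig.
by rewrite -bigE // inE.
Qed.

Lemma card_large (R : realFieldType) (m : R) F (K : nat) : K%:R <= m ->
  (#|[set v | (m < #|component F v|%:R)%R]| + nb_small K F +
   #|[set v | (K <= #|component F v|)%N && (#|component F v|%:R <= m)%R]| = #|T|)%N.
Proof.
move=> Km; rewrite /nb_small -!sum1dep_card -(@sum1_card T predT).
rewrite -addnA [RHS](bigID (fun v => m < #|component F v|%:R)) /=; congr addn.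
rewrite [RHS](bigID (fun v => #|component F v| < K)%N) /=; congr addn; apply: eq_bigl => v.
  case: (ltnP #|component F v| K) => h; rewrite ?andbF ?andbT //.
  by apply/esym/negP => /(le_lt_trans Km); rewrite ltr_nat ltnNge ltnW.
by rewrite -leqNgt -leNgt andbC.
Qed.

End RandomSubgraph.

(** * Contraction and mixing in Kneser graphs *)

Section Contraction.
Variables (R : archiRealFieldType) (V : finType) (e : rel V) (d : nat).
Hypotheses (e_sym : symmetric e) (reg : forall x, degree e x = d) (d_gt0 : (0 < d)%N).
Implicit Types (f g : V -> R) (x y : V).

(** On a [d]-regular graph this is the normalised adjacency operator. *)
Definition average f x : R := (\sum_(y | e x y) f y) / d%:R.
Definition dotp f g : R := \sum_x f x * g x.

Let d_neq0 : d%:R != 0 :> R.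
Proof. by rewrite pnatr_eq0 -lt0n. Qed.

Lemma dotp_ge0 f : 0 <= dotp f f.
Proof. by apply: sumr_ge0 => x _; rewrite -expr2 sqr_ge0. Qed.

Lemma dotp_average f g : dotp f (average g) = dotp (average f) g.
Proof.
rewrite /dotp /average.
rewrite (eq_bigr (fun x => \sum_y (e x y)%:R * f x * g y / d%:R)); last first.
  move=> x _; rewrite mulrA mulr_sumr mulr_suml big_mkcond; apply: eq_bigr => y _.
  by case: ifP; rewrite ?mul1r ?mul0r.
rewrite exchange_big; apply: eq_bigr => y _ /=; rewrite -mulrA mulr_suml.
rewrite [RHS]big_mkcond; apply: eq_bigr => x _; rewrite e_sym.
by case: ifP => _; rewrite ?mul0r // mul1r mulrAC mulrA.
Qed.

Lemma sum_average f : \sum_x average f x = \sum_x f x.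
Proof.
have := dotp_average (fun=> 1) f; rewrite /dotp.
under eq_bigr do rewrite mul1r.
move=> ->; apply: eq_bigr => x _; rewrite -[RHS]mul1r; congr (_ * _).
rewrite /average sumr_const (_ : #|[pred y | e x y]| = d) ?divff //.
by rewrite -(reg x) /degree; apply: eq_card => y; rewrite !inE.
Qed.

(** Lagrange's identity: twice the defect is a double sum of squares. *)
Lemma dotp_cauchy f g : dotp f g ^+ 2 <= dotp f f * dotp g g.
Proof.
suff : 0 <= dotp f f * dotp g g - dotp f g ^+ 2 by rewrite subr_ge0.
have E : (dotp f f * dotp g g - dotp f g ^+ 2) *+ 2 =
    \sum_x \sum_y (f x * g y - f y * g x) ^+ 2.
  rewrite (eq_bigr (fun x => f x * f x * dotp g g + g x * g x * dotp f f +
      - ((f x * g x) * (dotp f g *+ 2)))); last first.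
    move=> x _; rewrite /dotp -sumrMnl !mulr_sumr -sumrN -!big_split /=.
    by apply: eq_bigr => y _; ring.
  by rewrite !big_split /= sumrN -!mulr_suml -!/(dotp _ _); ring.
have : 0 <= (dotp f f * dotp g g - dotp f g ^+ 2) *+ 2.
  by rewrite E; apply: sumr_ge0 => x _; apply: sumr_ge0 => y _; apply: sqr_ge0.
by rewrite pmulrn_lge0.
Qed.

(** The relation [s] is a set of elementary moves, later the coordinate swaps. Averaging contracts
    the Lipschitz seminorm along moves by [kappa], and the total oscillation is at most [D] times
    that seminorm. *)
Variables (s : rel V) (kappa D : R).
Hypotheses (kappa_ge0 : 0 <= kappa).
Hypothesis contr : forall f (L : R), (forall x y, s x y -> `|f x - f y| <= L) ->
  forall x y, s x y -> `|average f x - average f y| <= kappa * L.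
Hypothesis diam : forall f (L : R), 0 <= L -> (forall x y, s x y -> `|f x - f y| <= L) ->
  forall x y, `|f x - f y| <= D * L.

(** After [m] averagings the seminorm is at most [kappa ^+ m * L]. A function of mean zero is at
    each point the average of its differences from that point, so [diam] bounds its supremum. The
    constant may be crude, since only the rate in [m] matters. *)
Lemma average_iter_bound f : \sum_x f x = 0 ->
  exists B, forall m, dotp (iter m average f) (iter m average f) <= B * (kappa ^+ 2) ^+ m.
Proof.
move=> f0; pose L : R := \sum_x \sum_y `|f x - f y|.
have L0 : 0 <= L by apply: sumr_ge0 => x _; apply: sumr_ge0 => y _.
have hL x y : `|f x - f y| <= L.
  rewrite /L (bigD1 x) //= (bigD1 y) //= -addrA lerDl addr_ge0 ?sumr_ge0 // => i _.
  by apply: sumr_ge0 => j _.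
have lip m : forall x y, s x y -> `|iter m average f x - iter m average f y| <= kappa ^+ m * L.
  elim: m => [|m IH] x y sxy; first by rewrite expr0 mul1r /= hL.
  by rewrite exprS -mulrA; apply: contr.
have mean m : \sum_x iter m average f x = 0.
  by elim: m => [//|m IH] /=; rewrite sum_average.
exists (#|V|%:R * (D * L) ^+ 2) => m; set g := iter m average f.
have bnd x : `|g x| <= D * L * kappa ^+ m.
  have cV : 0 < #|V|%:R :> R by rewrite ltr0n; apply/card_gt0P; exists x.
  rewrite -(ler_pM2l cV); have -> : #|V|%:R * `|g x| = `|\sum_y (g x - g y)|.
    by rewrite big_split /= sumrN mean subr0 sumr_const -[X in _ = `|X|]mulr_natl normrM ger0_norm ?ler0n.
  apply: le_trans (ler_norm_sum _ _ _) _.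
  apply: le_trans (_ : \sum_(y : V) D * (kappa ^+ m * L) <= _).
    by apply: ler_sum => y _; apply: diam (lip m) _ _; rewrite mulr_ge0 ?exprn_ge0.
  by rewrite sumr_const -[leLHS]mulr_natl -!mulrA [kappa ^+ m * L]mulrC.
apply: le_trans (_ : \sum_(x : V) (D * L * kappa ^+ m) ^+ 2 <= _).
  apply: ler_sum => x _; rewrite -expr2 -real_normK ?num_real //.
  by rewrite lerXn2r ?nnegrE // (le_trans _ (bnd x)).
by rewrite sumr_const -[leLHS]mulr_natl exprMn -mulrA -!exprM mulnC.
Qed.

(* The squared norms of the iterates are log-convex along powers of two, so
   their first ratio is at most the asymptotic rate kappa^2. *)
Lemma average_norm f : \sum_x f x = 0 ->
  dotp (average f) (average f) <= kappa ^+ 2 * dotp f f.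
Proof.
move=> f0; have [B hB] := average_iter_bound f0.
pose n m := dotp (iter m average f) (iter m average f).
have n_ge0 m : 0 <= n m by apply: dotp_ge0.
have shift m k g h : dotp (iter m average g) (iter k average h) =
    dotp g (iter (m + k) average h).
  elim: m g => [//|m IH] g; rewrite iterSr IH /= -dotp_average.
  by rewrite -iterS.
(* By self-adjointness [n m] pairs [f] with its iterate of order [m.*2]; then apply
   Cauchy-Schwarz. *)
have sq m : n m ^+ 2 <= n 0%N * n m.*2.
  by rewrite {1}/n shift -addnn; apply: dotp_cauchy.
have pow j : n 0%N * n 1%N ^+ (2 ^ j) <= n 0%N ^+ (2 ^ j) * n (2 ^ j)%N.
  elim: j => [|j IH]; first by rewrite !expr1.
  have [n0|n0] := eqVneq (n 0%N) 0.
    by rewrite n0 mul0r mulr_ge0 ?exprn_ge0.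
  have {}n0 : 0 < n 0%N by rewrite lt_def n0 n_ge0.
  rewrite -(ler_pM2l n0) expnSr muln2.
  apply: le_trans (_ : (n 0%N ^+ (2 ^ j) * n (2 ^ j)%N) ^+ 2 <= _).
    apply: le_trans (_ : (n 0%N * n 1%N ^+ (2 ^ j)) ^+ 2 <= _).
      by rewrite -addnn exprD -expr2 le_eqVlt; apply/orP; left; apply/eqP; ring.
    by rewrite lerXn2r ?nnegrE ?mulr_ge0 ?exprn_ge0.
  rewrite exprMn -exprM muln2 [leRHS]mulrCA ler_wpM2l ?exprn_ge0 //.
have -> : dotp (average f) (average f) = n 1%N by [].
have -> : dotp f f = n 0%N by [].
rewrite leNgt; apply/negP => lt1.
set q := _ * n 0%N in lt1.
have q_ge0 : 0 <= q by rewrite mulr_ge0 ?exprn_ge0.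
have n1_gt0 : 0 < n 1%N by apply: le_lt_trans lt1.
have n0_gt0 : 0 < n 0%N.
  rewrite lt_def n_ge0 andbT; apply/eqP => n0; have := sq 1%N.
  by rewrite n0 mul0r leNgt exprn_gt0.
have key j : n 0%N * n 1%N ^+ (2 ^ j) <= B * q ^+ (2 ^ j).
  apply: le_trans (pow j) _; rewrite exprMn [leRHS]mulrA [leRHS]mulrC ler_wpM2l ?exprn_ge0 //.
  exact: hB.
have [q0|q_neq0] := eqVneq q 0.
  by have := key 0%N; rewrite !expr1 q0 mulr0 leNgt mulr_gt0.
have q_gt0 : 0 < q by rewrite lt_def q_neq0.
(* By [key] the powers of [n 1 / q = 1 + h] with exponent [2 ^ j] are bounded by a constant, whereas
   Bernoulli's inequality makes them at least [j * h]. *)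
pose h := n 1%N / q - 1.
have h_gt0 : 0 < h by rewrite subr_gt0 ltr_pdivlMr // mul1r.
have bern j : j%:R * h <= (n 1%N / q) ^+ j.
  suff : 1 + j%:R * h <= (n 1%N / q) ^+ j by apply: le_trans; rewrite lerDr.
  elim: j => [|j IH]; first by rewrite mul0r addr0.
  rewrite exprS; have -> : n 1%N / q = 1 + h by rewrite addrC subrK.
  rewrite -natr1; have := ler_wpM2l (addr_ge0 ler01 (ltW h_gt0)) IH.
  rewrite [n 1%N / q](_ : _ = 1 + h); last by rewrite addrC subrK.
  apply: le_trans; have : 0 <= h * (j%:R * h) by rewrite !mulr_ge0 ?ler0n ?(ltW h_gt0).
  lra.
have := archi_boundP (_ : 0 <= `|B| / n 0%N / h); rewrite !divr_ge0 ?normr_ge0 ?ltW //.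
move=> /(_ isT); set j := Num.bound _; rewrite ltNge => /negP; apply.
rewrite ler_pdivlMr // ler_pdivlMr // mulrC.
apply: le_trans (_ : n 0%N * (n 1%N / q) ^+ (2 ^ j) <= _).
  rewrite ler_wpM2l //; apply: le_trans (bern _) _.
  have y1 : 1 <= n 1%N / q by rewrite ler_pdivlMr // mul1r; apply: ltW.
  have j2 : (j <= 2 ^ j)%N by apply/ltnW/ltn_expl.
  exact: ler_weXn2l y1 _ _ j2.
apply: le_trans (ler_norm B); rewrite expr_div_n mulrA ler_pdivrMr ?exprn_gt0 //.
Qed.

Lemma average_dotp f : \sum_x f x = 0 -> dotp f (average f) <= kappa * dotp f f.
Proof.
move=> f0; apply: le_trans (ler_norm _) _.
rewrite -(@ler_pXn2r _ 2) ?nnegrE ?mulr_ge0 ?dotp_ge0 // real_normK ?num_real //.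
apply: le_trans (dotp_cauchy _ _) _.
rewrite exprMn [dotp f f ^+ 2]expr2 mulrCA ler_wpM2l ?dotp_ge0 //.
exact: average_norm.
Qed.

(** The upper half of the expander mixing lemma: the quadratic form bound is applied to the
    indicator of [S] minus its mean. *)
Lemma mixing (S : {set V}) :
  (\sum_(x in S) #|[set y in S | e x y]|)%:R <=
  d%:R * #|S|%:R * (#|S|%:R / #|V|%:R + kappa).
Proof.
have [->|[x0 _]] := set_0Vmem S; first by rewrite big_set0 cards0 mulr0 mul0r.
have cV : #|V|%:R != 0 :> R by rewrite pnatr_eq0 -lt0n; apply/card_gt0P; exists x0.
pose g x : R := (x \in S)%:R; pose c : R := #|S|%:R / #|V|%:R.
have sg : \sum_x g x = #|S|%:R.
  by rewrite /g -natr_sum -sum1_card [in RHS]big_mkcond.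
have sc : \sum_(x : V) c = #|S|%:R.
  by rewrite sumr_const -[LHS]mulr_natl mulrC divfK.
pose f x := g x - c.
have sf : \sum_x f x = 0 by rewrite big_split /= sumrN sg sc subrr.
have af x : average f x = average g x - c.
  rewrite /average big_split /= sumrN mulrBl sumr_const; congr (_ - _).
  have -> : #|e x| = d by rewrite -(reg x) /degree cardsE.
  by rewrite -[c *+ d]mulr_natr mulfK.
have := average_dotp sf.
have -> : dotp f (average f) = dotp g (average g) - c * #|S|%:R.
  rewrite /dotp; under eq_bigr do rewrite af mulrBr.
  rewrite big_split /= sumrN -mulr_suml sf mul0r subr0.
  under eq_bigr do rewrite mulrBl.
  by rewrite big_split /= sumrN -mulr_sumr sum_average sg.
have -> : dotp f f = #|S|%:R - c * #|S|%:R.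
  rewrite /dotp; under eq_bigr do rewrite {2}/f mulrBr.
  rewrite big_split /= sumrN -mulr_suml sf mul0r subr0.
  under eq_bigr do rewrite mulrBl.
  rewrite big_split /= sumrN -mulr_sumr sg; congr (_ - _).
  by rewrite -sg; apply: eq_bigr => x _; rewrite /g; case: (x \in S); rewrite ?mulr0 ?mulr1.
have -> : dotp g (average g) = (\sum_(x in S) #|[set y in S | e x y]|)%:R / d%:R.
  rewrite natr_sum mulr_suml [RHS]big_mkcond; apply: eq_bigr => x _.
  rewrite /g /average; case: (x \in S); rewrite ?mul0r // mul1r; congr (_ / _).
  rewrite -sum1dep_card natr_sum [RHS]big_mkcond [LHS]big_mkcond; apply: eq_bigr => y _.
  by case: (y \in S); case: (e x y).
rewrite lerBlDr ler_pdivrMr ?ltr0n // => /le_trans; apply.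
have -> : d%:R * #|S|%:R * (c + kappa) = (kappa * #|S|%:R + c * #|S|%:R) * d%:R by ring.
by rewrite ler_wpM2r // lerD2r ler_wpM2l // gerBl mulr_ge0 // divr_ge0.
Qed.

End Contraction.

(** * Coordinate swaps in the Kneser graph *)

Section Johnson.
Variables n r : nat.
Implicit Types (v w x y : johnson_vertex n r) (a b i : 'I_n).
Local Notation G := (johnson n r 0).

Definition supp v : {set 'I_n} := [set i | val v i].

Lemma card_supp v : #|supp v| = r.
Proof. by rewrite /supp -weightE; apply/eqP/(valP v). Qed.

Lemma supp_inj : injective supp.
Proof.
by move=> v w /setP h; apply/val_inj/ffunP => i; have := h i; rewrite !inE.
Qed.

Lemma johnsonE v w : G v w = (v != w) && [disjoint supp v & supp w].
Proof.
rewrite /johnson sum_nat_eq0; congr (_ && _).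
rewrite -setI_eq0; apply/forallP/eqP => [h|/setP h i] /=.
  by apply/setP => i; have := h i; rewrite !inE; case: (val v i); case: (val w i).
by have := h i; rewrite !inE; case: (val v i); case: (val w i).
Qed.

Lemma johnson_sym : symmetric G.
Proof. by move=> v w; rewrite !johnsonE eq_sym disjoint_sym. Qed.

Fact swap_subproof a b v : (\sum_i [ffun i => val v (tperm a b i)] i == r)%N.
Proof.
rewrite (reindex_inj (@perm_inj _ (tperm a b))) /= -[X in _ == X](eqP (valP v)).
by apply/eqP/eq_bigr => i _; rewrite ffunE tpermK.
Qed.

Definition swap a b v : johnson_vertex n r :=
  Sub [ffun i => val v (tperm a b i)] (swap_subproof a b v).

Lemma in_supp_swap a b v i : (i \in supp (swap a b v)) = (tperm a b i \in supp v).
Proof. by rewrite !inE SubK ffunE. Qed.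

Lemma swapK a b : involutive (swap a b).
Proof.
by move=> v; apply: supp_inj; apply/setP => i; rewrite !in_supp_swap tpermK.
Qed.

Lemma johnson_swap a b v w : G (swap a b v) (swap a b w) = G v w.
Proof.
rewrite !johnsonE (inj_eq (can_inj (@swapK a b))); congr (_ && _).
rewrite -!setI_eq0; apply/eqP/eqP => /setP h; apply/setP => i.
  by have := h (tperm a b i); rewrite !in_setI !in_supp_swap tpermK !inE.
by have := h (tperm a b i); rewrite !in_setI !in_supp_swap !inE.
Qed.

Lemma swap_id a b v : (a \in supp v) = (b \in supp v) -> swap a b v = v.
Proof.
move=> ab; apply: supp_inj; apply/setP => i; rewrite in_supp_swap.
by case: tpermP => [->|->|//].
Qed.

Definition swap_rel v w := [exists a, exists b, w == swap a b v].

(** Swapping two coordinates outside [supp x] is an automorphism fixing [x], so each of these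
    [n - r] coordinates lies in equally many neighbours. Then count pairs of a neighbour and a
    coordinate of it in two ways. *)
Lemma card_nbr_supp x b : b \notin supp x ->
  ((n - r) * #|[set w | G x w && (b \in supp w)]| = r * degree G x)%N.
Proof.
move=> bx; pose c i := #|[set w | G x w && (i \in supp w)]|.
have c_le i j : i \notin supp x -> j \notin supp x -> (c i <= c j)%N.
  move=> ix jx; rewrite /c -(card_imset _ (can_inj (@swapK i j))).
  apply/subset_leq_card/subsetP => w /imsetP[u]; rewrite inE => /andP[xu iu] ->.
  rewrite inE in_supp_swap tpermR iu andbT.
  by rewrite -{1}(@swap_id i j x) ?johnson_swap // (negbTE ix) (negbTE jx).
have -> : (n - r)%N = #|~: supp x| by rewrite [RHS]cardsCs setCK card_ord card_supp.
rewrite -[LHS]sum_nat_const.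
transitivity (\sum_(i in ~: supp x) \sum_(w | G x w) (i \in supp w))%N.
  apply: eq_bigr => i; rewrite inE => ix.
  rewrite -[LHS]/(c b) (_ : c b = c i); last by apply/eqP; rewrite eqn_leq !c_le.
  by rewrite /c -sum1dep_card big_mkcondr; apply: eq_bigr => w _; case: (i \in supp w).
rewrite exchange_big /= mulnC -sum_nat_const.
rewrite big_mkcond [RHS]big_mkcond; apply: eq_bigr => w _; rewrite inE.
case: ifP => // xw; rewrite -(card_supp w) -sum1_card [LHS]big_mkcond [RHS]big_mkcond.
apply: eq_bigr => i _; rewrite in_setC; case: (boolP (i \in supp w)) => iw; last by rewrite if_same.
move: xw; rewrite johnsonE => /andP[_]; rewrite disjoint_sym => /pred0P/(_ i) /=.
by rewrite iw /= => ->.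
Qed.

Section Mixing.
Variable R : archiRealFieldType.
Hypotheses (r_gt0 : (0 < r)%N) (r_lt : (r + r <= n)%N).
Let kappa : R := r%:R / (n - r)%:R.

Let d := 'C(n - r, r).

Let reg v : degree G v = d.
Proof. exact: degree_johnson. Qed.

Let d_gt0 : (0 < d)%N.
Proof. by rewrite bin_gt0 leq_subRL // (leq_trans _ r_lt) ?leq_addr. Qed.

(** The swap carries neighbours of [x] to neighbours of the swapped vertex. With [a] in [supp x] and
    [b] outside, a neighbour misses [a], so it moves only if it contains [b], which a fraction
    [r / (n - r)] of them do. *)
Lemma johnson_contract (f : johnson_vertex n r -> R) (L : R) :
  (forall x y, swap_rel x y -> `|f x - f y| <= L) ->
  forall x y, swap_rel x y ->
    `|average G d f x - average G d f y| <= kappa * L.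
Proof.
move=> hf x y /existsP[a /existsP[b /eqP ->]].
have fx w : `|f w - f (swap a b w)| <= L.
  by apply: hf; apply/existsP; exists a; apply/existsP; exists b.
have L0 : 0 <= L by apply: le_trans (fx x).
(* Otherwise the swap fixes [x], or [a] and [b] exchange roles. *)
wlog [ax bx] : a b fx / a \in supp x /\ b \notin supp x.
  move=> W; case: (boolP (a \in supp x)) => ax; case: (boolP (b \in supp x)) => bx.
  - by rewrite swap_id ?ax ?bx // subrr normr0 mulr_ge0 // divr_ge0.
  - by apply: W.
  - have swC w : swap a b w = swap b a w by rewrite /swap; apply: supp_inj; apply/setP => i; rewrite !inE !ffunE tpermC.
    by rewrite swC; apply: W => // w; rewrite -swC.
  - by rewrite swap_id ?(negbTE ax) ?(negbTE bx) // subrr normr0 mulr_ge0 // divr_ge0.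
have -> : average G d f x - average G d f (swap a b x) =
    (\sum_(w | G x w) (f w - f (swap a b w))) / d%:R.
  rewrite /average -mulrBl; congr (_ / _); rewrite big_split /= sumrN; congr (_ - _).
  rewrite (reindex_inj (can_inj (@swapK a b))) /=.
  by apply: eq_bigl => w; rewrite johnson_swap.
rewrite normrM normfV [`|d%:R|]ger0_norm // ler_pdivrMr ?ltr0n //.
apply: le_trans (ler_norm_sum _ _ _) _.
apply: (@le_trans _ _ (\sum_(w | G x w && (b \in supp w)) L)).
  rewrite [leRHS]big_mkcondr; apply: ler_sum => w xw; case: ifP => // bw.
  rewrite swap_id ?subrr ?normr0 // bw.
  move: xw; rewrite johnsonE => /andP[_] /pred0P/(_ a) /=; rewrite ax; exact.
rewrite sumr_const -[leLHS]mulr_natl mulrAC ler_wpM2r //.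
rewrite /kappa mulrAC ler_pdivlMr ?ltr0n ?subn_gt0 //; last by apply: leq_trans r_lt; rewrite -addn1 leq_add2l.
rewrite -!natrM ler_nat mulnC -(reg x) -(@card_nbr_supp x b bx).
by rewrite cardsE.
Qed.

(** Swapping an element of [supp x :\: supp y] with one of [supp y :\: supp x] shrinks the
    difference by one, so at most [n] swaps lead from [x] to [y]. *)
Lemma johnson_diam (f : johnson_vertex n r -> R) (L : R) : 0 <= L ->
  (forall x y, swap_rel x y -> `|f x - f y| <= L) ->
  forall x y, `|f x - f y| <= n%:R * L.
Proof.
move=> L0 hf x y; apply: (@le_trans _ _ (#|supp x :\: supp y|%:R * L)); last first.
  by rewrite ler_wpM2r // ler_nat -[leqRHS]card_ord max_card.
move: {2}#|_| (erefl #|supp x :\: supp y|) => m; elim: m x => [|m IH] x xy.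
  rewrite xy mul0r (_ : x = y) ?subrr ?normr0 //; apply: supp_inj; apply/eqP.
  by move/eqP: xy; rewrite cards_eq0 setD_eq0 eqEcard => ->; rewrite !card_supp leqnn.
have /card_gt0P[a] : (0 < #|supp x :\: supp y|)%N by rewrite xy.
rewrite in_setD => /andP[ay ax].
have /card_gt0P[b] : (0 < #|supp y :\: supp x|)%N.
  suff -> : #|supp y :\: supp x| = #|supp x :\: supp y| by rewrite xy.
  apply/eqP; rewrite -(eqn_add2l #|supp x :&: supp y|) cardsID setIC cardsID.
  by rewrite !card_supp.
rewrite in_setD => /andP[bx by_].
have e1 : supp (swap a b x) :\: supp y = (supp x :\: supp y) :\ a.
  apply/setP => i; rewrite !in_setD in_supp_swap !in_set1.
  case: tpermP => [->|->|/eqP ia /eqP ib]; rewrite ?eqxx ?ay ?(negbTE bx) ?by_ ?andbF //.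
  by rewrite ia.
have m1 : #|supp (swap a b x) :\: supp y| = m.
  by rewrite e1; move: xy; rewrite (cardsD1 a) in_setD ay ax => -[].
have := IH _ m1; rewrite m1 xy -natr1 mulrDl mul1r => h.
rewrite -(subrKA (f (swap a b x))); apply: le_trans (ler_normD _ _) _.
rewrite addrC lerD //; apply: hf; apply/existsP; exists a; apply/existsP; exists b.
by rewrite eqxx.
Qed.

Lemma johnson_mixing (S : {set johnson_vertex n r}) :
  (\sum_(x in S) #|[set y in S | G x y]|)%:R <=
  d%:R * #|S|%:R * (#|S|%:R / #|johnson_vertex n r|%:R + kappa).
Proof.
apply: (@mixing _ _ _ d johnson_sym reg d_gt0 swap_rel kappa n%:R).
- by rewrite divr_ge0.
- exact: johnson_contract.
- exact: johnson_diam.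
Qed.

End Mixing.

End Johnson.

(* Imported only now because classical_sets shadows the finset notations and
   lemma names used above. *)
From mathcomp Require Import all_classical all_reals all_analysis.
Import numFieldNormedType.Exports.

(** * Comparing edge probabilities *)

Section Weights.
Variable R : realType.
Implicit Types a b D : R.

(** Use [1 + x <= expR x] twice: for [1 - a / D], and for the inverse of [1 - b / D], which is
    [1 + b / (D - b)]. *)
Lemma weight_ratio_le a b D m : 0 < D -> a <= D -> b < D ->
  ((1 - a / D) / (1 - b / D)) ^+ m <= expR (m%:R * (b / (D - b) - a / D)).
Proof.
move=> D0 aD bD; have Db : 0 < D - b by rewrite subr_gt0.
have b1 : 0 < 1 - b / D by rewrite subr_gt0 ltr_pdivrMr // mul1r.
have a1 : 0 <= 1 - a / D by rewrite subr_ge0 ler_pdivrMr // mul1r.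
rewrite expRM_natl lerXn2r ?nnegrE ?expR_ge0 ?divr_ge0 ?(ltW b1) //.
rewrite [X in expR X]addrC expRD ler_pM ?invr_ge0 ?(ltW b1) //; first exact: (expR_ge1Dx (- (a / D))).
rewrite (_ : _^-1 = 1 + b / (D - b)); first exact: expR_ge1Dx.
by field; rewrite !gt_eqF // subr_gt0.
Qed.

Lemma weight_ratio_ge a b D m : 0 < D -> a < D -> b < D ->
  expR (m%:R * (b / D - a / (D - a))) <= ((1 - a / D) / (1 - b / D)) ^+ m.
Proof.
move=> D0 aD bD; rewrite -[leRHS]invrK -exprVn invf_div.
have b1 : 0 < 1 - b / D by rewrite subr_gt0 ltr_pdivrMr // mul1r.
have a1 : 0 < 1 - a / D by rewrite subr_gt0 ltr_pdivrMr // mul1r.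
rewrite -[leLHS]invrK -expRN -mulrN opprB lef_pV2 ?posrE ?expR_gt0 //.
  by apply: weight_ratio_le => //; apply: ltW.
by rewrite exprn_gt0 // divr_gt0.
Qed.

End Weights.

(** The clause [d <= #|T|] lets a lower bound on the degree also force many vertices. *)
Definition pseudorandom (R : realType) (T : finType) (e : rel T) (d : nat) (kappa : R) :=
  [/\ symmetric e, forall x, degree e x = d, (d <= #|T|)%N &
    forall S : {set T}, (\sum_(x in S) #|[set y in S | e x y]|)%:R <=
      d%:R * #|S|%:R * (#|S|%:R / #|T|%:R + kappa)].

(** * Exponential tails for component sizes *)

Section Tails.
Variables (R : realType) (T : finType) (e : rel T) (d : nat).
Implicit Types (a b p q c t g : R) (v : T) (S : {set T}).

Lemma prob_subgraphE p (A : pred {set {set T}}) :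
  prob_subgraph e p A = expect (edges e) p (fun F => (A F)%:R).
Proof.
rewrite /prob_subgraph big_mkcondr; apply: eq_bigr => F _.
by case: (A F); rewrite ?mulr1 ?mulr0.
Qed.

Lemma expect_component_le p q c v (Q : pred nat) :
  (forall S, v \in S -> Q #|S| -> prob_component e p v S <= c * prob_component e q v S) ->
  expect (edges e) p (fun F => (Q #|component F v|)%:R) <=
  c * expect (edges e) q (fun F => (Q #|component F v|)%:R).
Proof.
move=> h; rewrite !expect_component mulr_sumr; apply: ler_sum => S /andP[vS QS].
exact: h.
Qed.

Lemma expect_component_ge p q c v (Q : pred nat) :
  (forall S, v \in S -> Q #|S| -> c * prob_component e q v S <= prob_component e p v S) ->
  c * expect (edges e) q (fun F => (Q #|component F v|)%:R) <=
  expect (edges e) p (fun F => (Q #|component F v|)%:R).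
Proof.
move=> h; rewrite !expect_component mulr_sumr; apply: ler_sum => S /andP[vS QS].
exact: h.
Qed.

Lemma expect_pred_le1 p (Q : pred {set {set T}}) : 0 <= p <= 1 ->
  expect (edges e) p (fun F => (Q F)%:R) <= 1.
Proof.
move=> p01; rewrite -[leRHS](expect_cst (edges e) p 1); apply: le_expect => // F _.
by case: (Q F).
Qed.

Lemma prob_component_ge0 p v S : 0 <= p <= 1 -> 0 <= prob_component e p v S.
Proof. by move=> p01; apply: expect_ge0. Qed.

Hypotheses (e_sym : symmetric e) (reg : forall x, degree e x = d).
Let D : R := d%:R.

Lemma exprn_pred (x : R) k : 0 < x -> (0 < k)%N -> x ^+ k.-1 = x^-1 * expR (k%:R * ln x).
Proof.
by move=> x0 k0; rewrite expRM_natl lnK // -{2}(prednK k0) exprS mulKf // gt_eqF.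
Qed.

(** This is [prob_component_ge] from [a / D] up to [1 / D]. The rate per vertex is [a - 1 - ln a],
    at least [2 * g]; one [g] absorbs the error [(D - 1)^-1] and the other remains. *)
Lemma subcritical_component a g v S : 0 < a < 1 -> ln a + (1 - a) + 2 * g <= 0 ->
  1 < D -> (D - 1)^-1 <= g -> v \in S ->
  prob_component e (a / D) v S <=
  a^-1 * expR (- (g * #|S|%:R)) * prob_component e (1 / D) v S.
Proof.
move=> /andP[a0 a1] hg D1 Dg vS; have D0 : 0 < D by apply: lt_trans D1.
have k0 : (0 < #|S|)%N by apply/card_gt0P; exists v.
have aD : 0 < a / D <= 1 / D by rewrite divr_gt0 // ler_pM2r ?invr_gt0 // ltW.
have D1' : 1 / D < 1 by rewrite ltr_pdivrMr // mul1r.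
have := prob_component_ge e aD D1' vS; set k := #|S| in k0 *; set P := prob_component e _ _ _.
set rho : R := (1 - 1 / D) / (1 - a / D).
have rho1 : 0 <= rho <= 1.
  have h1 : 0 < 1 - a / D by rewrite subr_gt0 ltr_pdivrMr // mul1r (lt_trans a1).
  rewrite divr_ge0 ?(ltW h1) ?subr_ge0 ?(ltW D1') //= ler_pdivrMr //.
  by case/andP: aD => _; lra.
have P0 : 0 <= P.
  by apply: prob_component_ge0; rewrite divr_ge0 ?(ltW a0) ?(ltW D0) //= ler_pdivrMr // mul1r ltW // (lt_trans a1).
move=> h; rewrite expRN -invfM mulrC ler_pdivlMr ?mulr_gt0 ?expR_gt0 // mulrC.
apply: le_trans h; rewrite ler_wpM2r //.
have -> : 1 / D / (a / D) = a^-1 by field; rewrite !gt_eqF.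
rewrite exprn_pred ?invr_gt0 // invrK -mulrA ler_pM2l // lnV ?posrE //.
apply: (@le_trans _ _ (expR (k%:R * - ln a) * rho ^+ (k * d))); last first.
  rewrite ler_wpM2l ?expR_ge0 // ler_wiXn2l ?card_touching //; by case/andP: rho1.
have aD' : a < D by apply: lt_trans D1.
have := @weight_ratio_ge _ 1 a D (k * d) D0 D1 aD'.
rewrite -(ler_pM2l (expR_gt0 (k%:R * - ln a))); apply: le_trans.
rewrite -expRD ler_expR natrM -/D.
have -> : k%:R * D * (a / D - 1 / (D - 1)) = k%:R * (a - 1 - (D - 1)^-1).
  by field; rewrite !gt_eqF // subr_gt0.
by rewrite -mulrDr mulrC ler_wpM2l //; move: hg Dg; lra.
Qed.

Lemma subcritical_tail a g v t : 0 < a < 1 -> ln a + (1 - a) + 2 * g <= 0 ->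
  0 <= g -> 1 < D -> (D - 1)^-1 <= g ->
  expect (edges e) (a / D) (fun F => (t <= #|component F v|%:R)%R%:R)
    <= a^-1 * expR (- (g * t)).
Proof.
move=> a01 hg g0 D1 Dg; have D0 : 0 < D by apply: lt_trans D1.
have D01 : 0 <= 1 / D <= 1 by rewrite divr_ge0 ?(ltW D0) //= ler_pdivrMr // mul1r ltW.
have c0 : 0 <= a^-1 * expR (- (g * t)).
  by case/andP: a01 => a0 _; rewrite mulr_ge0 ?expR_ge0 ?invr_ge0 ?ltW.
apply: le_trans (@expect_component_le (a / D) (1 / D) (a^-1 * expR (- (g * t))) v
  (fun k => t <= k%:R)%R _) _.
  move=> S vS tS; apply: le_trans (subcritical_component a01 hg D1 Dg vS) _.
  rewrite ler_wpM2r ?prob_component_ge0 // ler_wpM2l //.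
    by case/andP: a01 => /ltW; rewrite invr_ge0.
  by rewrite ler_expR lerN2 ler_wpM2l.
by rewrite -[leRHS]mulr1 ler_wpM2l //; apply: (@expect_pred_le1 _ (fun F => t <= _)).
Qed.

Variables (alpha beta x0 kappa g : R).

(** Passing from [beta] to [alpha] gains at most [ln (alpha / beta)] per vertex from the spanning
    tree. Mixing gives [S] at least [(1 - x0 - kappa) * D] boundary edges per vertex, and the
    absence of each costs about [(alpha - beta) / D]. The cost wins by [g]. *)
Lemma gap_component v S : 0 < beta < alpha -> 0 <= g -> alpha < D ->
  (forall S : {set T}, (\sum_(x in S) #|[set y in S | e x y]|)%:R <=
      D * #|S|%:R * (#|S|%:R / #|T|%:R + kappa)) ->
  1 <= alpha / beta ->
  0 <= alpha - beta - beta ^+ 2 / (D - beta) ->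
  ln (alpha / beta) + g <= (1 - x0 - kappa) * (alpha - beta - beta ^+ 2 / (D - beta)) ->
  v \in S -> #|S|%:R <= x0 * #|T|%:R ->
  prob_component e (alpha / D) v S <=
  expR (- (g * #|S|%:R)) * prob_component e (beta / D) v S.
Proof.
move=> /andP[b0 ba] g0 aD mix ab1 w0 hw vS Sx.
have a0 := lt_trans b0 ba; have D0 := lt_trans a0 aD.
have k0 : (0 < #|S|)%N by apply/card_gt0P; exists v.
have T0 : 0 < #|T|%:R :> R by rewrite ltr0n; apply/card_gt0P; exists v.
have bD : beta < D by apply: lt_trans aD.
have baD : 0 < beta / D <= alpha / D by rewrite divr_gt0 // ler_pM2r ?invr_gt0 // ltW.
have aD1 : alpha / D < 1 by rewrite ltr_pdivrMr // mul1r.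
apply: le_trans (prob_component_le e baD aD1 vS) _.
rewrite ler_wpM2r //.
  apply: prob_component_ge0; rewrite divr_ge0 ?(ltW b0) ?(ltW D0) //=.
  by rewrite ler_pdivrMr // mul1r ltW.
have -> : alpha / D / (beta / D) = alpha / beta by field; rewrite !gt_eqF.
rewrite exprn_pred ?divr_gt0 //.
have ba0 : 0 < alpha / beta by rewrite divr_gt0.
apply: le_trans (_ : expR (#|S|%:R * ln (alpha / beta)) * expR (- (#|S|%:R * (ln (alpha / beta) + g))) <= _); last first.
  by rewrite -expRD ler_expR mulrDr opprD addrA addrN add0r mulrC.
rewrite ler_pM //.
- by rewrite mulr_ge0 ?expR_ge0 // invr_ge0 ltW.
- by rewrite exprn_ge0 // divr_ge0 // subr_ge0 ltW // ltr_pdivrMr // mul1r.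
- by rewrite ler_piMl ?expR_ge0 // invf_le1.
apply: le_trans (weight_ratio_le _ D0 (ltW aD) bD) _.
rewrite ler_expR.
have bdry : #|S|%:R * (1 - x0 - kappa) <= #|boundary e S|%:R / D.
  rewrite ler_pdivlMr //.
  have := card_boundary_ge reg S; rewrite -(ler_nat R) natrD natrM -/D => hb.
  have h2 : #|S|%:R / #|T|%:R <= x0 by rewrite ler_pdivrMr.
  have h3 := mix S.
  have h4 : D * #|S|%:R * (#|S|%:R / #|T|%:R + kappa) <= D * #|S|%:R * (x0 + kappa).
    by rewrite ler_wpM2l ?mulr_ge0 ?(ltW D0) // lerD2r.
  have -> : #|S|%:R * (1 - x0 - kappa) * D = #|S|%:R * D - D * #|S|%:R * (x0 + kappa) by ring.
  lra.
have -> : #|boundary e S|%:R * (beta / (D - beta) - alpha / D) =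
  - (#|boundary e S|%:R / D * (alpha - beta - beta ^+ 2 / (D - beta))).
  by field; rewrite !gt_eqF // subr_gt0.
rewrite lerN2; apply: le_trans (_ : #|S|%:R * (1 - x0 - kappa) * (alpha - beta - beta ^+ 2 / (D - beta)) <= _).
  by rewrite -mulrA ler_wpM2l.
by rewrite ler_wpM2r.
Qed.

Lemma gap_tail v t : 0 < beta < alpha -> 0 <= g -> alpha < D ->
  (forall S : {set T}, (\sum_(x in S) #|[set y in S | e x y]|)%:R <=
      D * #|S|%:R * (#|S|%:R / #|T|%:R + kappa)) ->
  1 <= alpha / beta ->
  0 <= alpha - beta - beta ^+ 2 / (D - beta) ->
  ln (alpha / beta) + g <= (1 - x0 - kappa) * (alpha - beta - beta ^+ 2 / (D - beta)) ->
  expect (edges e) (alpha / D)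
    (fun F => ((t <= #|component F v|%:R) && (#|component F v|%:R <= x0 * #|T|%:R))%R%:R)
    <= expR (- (g * t)).
Proof.
move=> ba g0 aD mix ab1 w0 hw.
have [b0 bD] : 0 < beta /\ beta < D by case/andP: ba => b0 ba; split=> //; apply: lt_trans aD.
have D0 : 0 < D := lt_trans b0 bD.
apply: le_trans (@expect_component_le (alpha / D) (beta / D) (expR (- (g * t))) v
  (fun k => (t <= k%:R)%R && (k%:R <= x0 * #|T|%:R)%R) _) _.
  move=> S vS /andP[tS Sx]; apply: le_trans (gap_component ba g0 aD mix ab1 w0 hw vS Sx) _.
  rewrite ler_wpM2r // ?ler_expR ?lerN2 ?ler_wpM2l //.
  by apply: prob_component_ge0; rewrite divr_ge0 ?(ltW b0) ?(ltW D0) //= ler_pdivrMr // mul1r ltW.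
rewrite -[leRHS]mulr1 ler_wpM2l ?expR_ge0 //.
apply: (@expect_pred_le1 _ (fun F => (t <= #|component F v|%:R)%R && (_ <= _)%R)).
by rewrite divr_ge0 ?(ltW b0) ?(ltW D0) //= ler_pdivrMr // mul1r ltW.
Qed.

End Tails.

(** * Duality for components of bounded size *)

Section Duality.
Variables (R : realType) (T : finType) (e : rel T) (d : nat).
Hypotheses (e_sym : symmetric e) (reg : forall x, degree e x = d).
Let D : R := d%:R.
Variables (K : nat) (alpha b eta : R).
Hypotheses (b_gt0 : 0 < b) (ba : b < alpha) (aD : alpha < D).
Hypothesis dual : ln alpha - alpha = ln b - b.

Let a0 : 0 < alpha := lt_trans b_gt0 ba.
Let D0 : 0 < D := lt_trans a0 aD.
Let bD : b < D := lt_trans ba aD.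

Let lnab : ln (alpha / b) = alpha - b.
Proof. by rewrite ln_div ?posrE //; move: dual; lra. Qed.

(** The boundary factor, close to [expR (- (#|S|%:R * (alpha - b)))], will cancel this exponential
    and leave [b / alpha] whatever the size of [S]. *)
Let dual_pow (S : {set T}) v : v \in S ->
  (alpha / D / (b / D)) ^+ #|S|.-1 = b / alpha * expR (#|S|%:R * (alpha - b)).
Proof.
move=> vS; have k0 : (0 < #|S|)%N by apply/card_gt0P; exists v.
have -> : alpha / D / (b / D) = alpha / b by field; rewrite !gt_eqF.
by rewrite exprn_pred ?divr_gt0 // lnab invf_div.
Qed.

Let bDaD : 0 < b / D <= alpha / D.
Proof. by rewrite divr_gt0 // ler_pM2r ?invr_gt0 // ltW. Qed.

Let aD1 : alpha / D < 1.
Proof. by rewrite ltr_pdivrMr // mul1r. Qed.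

Let Pb0 v (S : {set T}) : 0 <= prob_component e (b / D) v S.
Proof.
by apply: prob_component_ge0; rewrite divr_ge0 ?(ltW b_gt0) ?(ltW D0) //= ler_pdivrMr // mul1r ltW.
Qed.

(** A set of [k] vertices spans at most [k ^ 2] ordered adjacent pairs, so its boundary has between
    [k * D - k ^ 2] and [k * D] edges. For [k <= K] the cancellation is exact up to [expR eta]. *)
Lemma dual_component_le v (S : {set T}) :
  K%:R * b ^+ 2 / (D - b) + K%:R ^+ 2 * alpha / D <= eta ->
  v \in S -> (#|S| <= K)%N ->
  prob_component e (alpha / D) v S <= b / alpha * expR eta * prob_component e (b / D) v S.
Proof.
move=> heta vS SK; apply: le_trans (prob_component_le e bDaD aD1 vS) _.
rewrite ler_wpM2r // (dual_pow vS) -(mulrA (b / alpha)); apply: ler_wpM2l.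
  by rewrite divr_ge0 ?(ltW b_gt0) ?(ltW a0).
apply: le_trans (ler_wpM2l (expR_ge0 _) (weight_ratio_le _ D0 (ltW aD) bD)) _.
rewrite -expRD ler_expR; set k := #|S| in SK *; set B := #|boundary e S|.
have kK : k%:R <= K%:R :> R by rewrite ler_nat.
have B1 : B%:R <= k%:R * D.
  by rewrite -natrM ler_nat; apply: leq_trans (card_touching e_sym reg S); apply: leq_addl.
have B2 : k%:R * D <= B%:R + k%:R ^+ 2.
  rewrite -natrM expr2 -natrM -natrD ler_nat; apply: leq_trans (card_boundary_ge reg S) _.
  rewrite leq_add2l -[(k * k)%N]sum_nat_const; apply: leq_sum => x _.
  by apply: subset_leq_card; apply/fintype.subsetP => y; rewrite inE => /andP[].
have Db : 0 < D - b by rewrite subr_gt0.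
have -> : B%:R * (b / (D - b) - alpha / D) =
    B%:R / D * (b ^+ 2 / (D - b)) - B%:R / D * (alpha - b).
  by field; rewrite !gt_eqF.
have h1 : B%:R / D <= k%:R by rewrite ler_pdivrMr.
have h2 : k%:R - k%:R ^+ 2 / D <= B%:R / D.
  by rewrite lerBlDr -mulrDl ler_pdivlMr.
have h3 : B%:R / D * (b ^+ 2 / (D - b)) <= K%:R * (b ^+ 2 / (D - b)).
  rewrite ler_wpM2r ?divr_ge0 ?sqr_ge0 ?(ltW Db) //; exact: le_trans h1 kK.
have h4 : (k%:R - k%:R ^+ 2 / D) * (alpha - b) <= B%:R / D * (alpha - b).
  by rewrite ler_wpM2r // subr_ge0 ltW.
have h5 : k%:R ^+ 2 / D * (alpha - b) <= K%:R ^+ 2 * alpha / D.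
  rewrite mulrAC ler_wpM2r ?invr_ge0 ?(ltW D0) // ler_pM ?sqr_ge0 ?subr_ge0 ?(ltW ba) //.
    by rewrite lerXn2r ?nnegrE.
  by rewrite gerBl ltW.
rewrite mulrA in h3; lra.
Qed.

Lemma dual_component_ge v (S : {set T}) :
  K%:R * alpha ^+ 2 / (D - alpha) <= eta ->
  v \in S -> (#|S| <= K)%N ->
  b / alpha * expR (- eta) * prob_component e (b / D) v S <= prob_component e (alpha / D) v S.
Proof.
move=> heta vS SK; apply: le_trans (prob_component_ge e bDaD aD1 vS).
rewrite ler_wpM2r // (dual_pow vS) -(mulrA (b / alpha)); apply: ler_wpM2l.
  by rewrite divr_ge0 ?(ltW b_gt0) ?(ltW a0).
set k := #|S| in SK *.
have kK : k%:R <= K%:R :> R by rewrite ler_nat.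
have Da : 0 < D - alpha by rewrite subr_gt0.
apply: (@le_trans _ _ (expR (k%:R * (alpha - b)) * ((1 - alpha / D) / (1 - b / D)) ^+ (k * d))); last first.
  rewrite ler_wpM2l ?expR_ge0 // ler_wiXn2l ?card_touching //.
    by rewrite divr_ge0 // subr_ge0 ?(ltW aD1) // ler_pdivrMr // mul1r ltW.
  have bD1 : 0 < 1 - b / D by rewrite subr_gt0 ltr_pdivrMr // mul1r.
  by rewrite ler_pdivrMr // mul1r lerD2l lerN2; case/andP: bDaD.
have := @weight_ratio_ge _ alpha b D (k * d) D0 aD bD.
rewrite -(ler_pM2l (expR_gt0 (k%:R * (alpha - b)))); apply: le_trans.
rewrite -expRD ler_expR natrM -/D.
have -> : k%:R * D * (b / D - alpha / (D - alpha)) = - (k%:R * (alpha - b)) - k%:R * (alpha ^+ 2 / (D - alpha)).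
  by field; rewrite !gt_eqF.
have : k%:R * (alpha ^+ 2 / (D - alpha)) <= K%:R * (alpha ^+ 2 / (D - alpha)).
  by rewrite ler_wpM2r // divr_ge0 ?sqr_ge0 ?(ltW Da).
rewrite mulrA in heta *; lra.
Qed.

End Duality.

(** * Calculus of the dual parameter *)

Section Calculus.
Variable R : realType.
Implicit Types a b c s x eta : R.

Lemma lnx_lt x : 0 < x -> x != 1 -> ln x < x - 1.
Proof.
move=> x0 x1; have l0 : ln x != 0.
  by apply: contra x1 => /eqP l; rewrite -(lnK x0) l expR0.
by have := expR_gt1Dx l0; rewrite lnK ?posrE //; lra.
Qed.

(** A limit in threshold form, so that several requirements of large degree combine through
    [Num.max]. *)
Lemma eventually_div c s eta : 0 <= c -> 0 < eta ->
  exists D0, forall D, D0 <= D -> s < D /\ c / (D - s) <= eta.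
Proof.
move=> c0 e0; exists (s + 1 + c / eta) => D hD.
have h : 0 <= c / eta by rewrite divr_ge0 // ltW.
have sD : 0 < D - s by lra.
split; first by lra.
by rewrite ler_pdivrMr // mulrC -ler_pdivrMr //; lra.
Qed.

Section Dual.
Variables alpha alphabar : R.
Hypotheses (alpha_gt1 : 1 < alpha) (neq : alphabar != alpha).
Hypothesis dual : alphabar * expR (- alphabar) = alpha * expR (- alpha).

Lemma dual_gt0 : 0 < alphabar.
Proof.
have : 0 < alphabar * expR (- alphabar) by rewrite dual mulr_gt0 ?expR_gt0 ?(lt_trans ltr01).
by rewrite pmulr_lgt0 ?expR_gt0.
Qed.

Lemma dual_ln : ln alpha - alpha = ln alphabar - alphabar.
Proof.
have a0 : 0 < alpha by apply: lt_trans alpha_gt1.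
have := congr1 (@ln R) dual; rewrite !lnM ?posrE ?expR_gt0 ?dual_gt0 // !expRK.
by move=> ->.
Qed.

(** By [key], [ln x - x] strictly decreases from 1 on, so two distinct points with equal values
    cannot both be at least 1. *)
Lemma dual_lt1 : alphabar < 1.
Proof.
rewrite ltNge; apply/negP => b1.
have key x y : 1 <= x -> x < y -> ln y - y < ln x - x.
  move=> x1 xy; have x0 : 0 < x by apply: lt_le_trans x1.
  have y0 : 0 < y by apply: lt_trans xy.
  have h : ln (y / x) < y / x - 1.
    by apply: lnx_lt; rewrite ?divr_gt0 // gt_eqF // ltr_pdivlMr // mul1r.
  rewrite ln_div ?posrE // in h.
  have : y / x - 1 <= y - x.
    rewrite -(divff (lt0r_neq0 x0)) -mulrBl ler_pdivrMr // ler_peMr //.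
    by rewrite subr_ge0 ltW.
  lra.
have := dual_ln; case: (ltgtP alphabar alpha) neq => // h _.
  by have := key _ _ b1 h; lra.
by have := key _ _ (ltW alpha_gt1) h; lra.
Qed.

(* With s = alpha - alphabar, duality reads alpha = e^s alphabar, and the claim
   becomes s (e^s + 1) > 2 (e^s - 1). *)
Lemma dual_sum : 2 < alpha + alphabar.
Proof.
pose s := alpha - alphabar.
have b0 := dual_gt0; have a0 : 0 < alpha by apply: lt_trans alpha_gt1.
have s0 : 0 < s by rewrite subr_gt0; apply: lt_trans dual_lt1 _.
have aE : alpha = expR s * alphabar.
  rewrite -[LHS]lnK ?posrE // (_ : ln alpha = s + ln alphabar) ?expRD ?lnK ?posrE //.
  by have := dual_ln; rewrite /s; lra.
(* The claim is [0 < h s]. Here [h 0 = 0], and [h'] is positive on positive reals because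
   [1 - c < expR (- c)]. *)
pose h (x : R) := (x - 2) * expR x + x + 2.
pose h' (x : R) := (x - 1) * expR x + 1.
have dh x : is_derive x 1 h (h' x).
  rewrite /h /h'; apply: is_derive_eq.
  by rewrite /= ?scaler0 ?addr0 ?subr0 /GRing.scale /=; ring.
have [|c] := @MVT R h h' 0 s s0 (fun x _ => dh x).
  by apply: derivable_within_continuous => x _; apply: ex_derive.
rewrite in_itv /= => /andP[c0 _] hE.
have h'c : 0 < h' c.
  have : 1 + - c < expR (- c) by apply: expR_gt1Dx; rewrite oppr_eq0 gt_eqF.
  rewrite expRN -[X in _ < X]mul1r ltr_pdivlMr ?expR_gt0 // /h'; lra.
have : 0 < h s.
  have -> : h s = h s - h 0 by rewrite /h expR0; ring.
  by rewrite hE mulr_gt0 // subr0.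
rewrite /h => hs.
have e1 : 0 < expR s - 1 by rewrite subr_gt0 -expR0 ltr_expR.
have sb : s = (expR s - 1) * alphabar by rewrite /s {1}aE; ring.
have : 0 < (expR s - 1) * (alpha + alphabar - 2).
  have -> : (expR s - 1) * (alpha + alphabar - 2) = s * (expR s + 1) - 2 * (expR s - 1).
    by move: (expR s) aE sb => E aE sb; rewrite sb aE; ring.
  lra.
by rewrite pmulr_rgt0 // subr_gt0.
Qed.

End Dual.
End Calculus.

(** * Density of vertices in small components *)

Section Density.
Variable R : realType.
Implicit Types (alpha alphabar a g eps eta : R).

Lemma subcritical_rate a : 0 < a < 1 -> exists2 g : R, 0 < g & ln a + (1 - a) + 2 * g <= 0.
Proof.
move=> /andP[a0 a1]; have h : ln a < a - 1 by apply: lnx_lt; rewrite ?lt_eqF.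
by exists ((a - 1 - ln a) / 2); lra.
Qed.

Lemma expR_decay (c g eps : R) : 0 < c -> 0 < g -> 0 < eps ->
  exists K0 : nat, forall K, (K0 <= K)%N -> c * expR (- (g * K%:R)) <= eps.
Proof.
move=> c0 g0 e0; have x0 : 0 <= `|ln (c / eps)| / g by rewrite divr_ge0 // ltW.
exists (Num.Def.archi_bound (`|ln (c / eps)| / g)) => K hK.
have h : `|ln (c / eps)| / g <= K%:R.
  by apply: le_trans (ltW (archi_boundP x0)) _; rewrite ler_nat.
rewrite -ler_pdivlMl // -[leRHS]lnK ?posrE ?mulr_gt0 ?invr_gt0 // ler_expR.
rewrite ler_pdivrMr // in h.
have -> : c^-1 * eps = (c / eps)^-1 by rewrite invf_div mulrC.
rewrite lnV ?posrE ?divr_gt0 // lerN2; apply: le_trans (ler_norm _) _; by rewrite [g * _]mulrC.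
Qed.

(** At the subcritical dual parameter the component of [v] has fewer than [K] vertices with
    probability near 1; duality multiplies this by nearly [alphabar / alpha]. The threshold [D0]
    comes after [K] because the duality error grows with [K]. *)
Lemma small_component_density alpha alphabar eps :
  1 < alpha -> 0 < alphabar < 1 -> ln alpha - alpha = ln alphabar - alphabar -> 0 < eps ->
  exists K0 : nat, forall K, (K0 <= K)%N -> exists D0 : R,
  forall (T : finType) (e : rel T) (d : nat), symmetric e -> (forall x, degree e x = d) ->
    D0 <= d%:R -> forall v : T,
    `|expect (edges e) (alpha / d%:R) (fun F => (#|component F v| < K)%N%:R)
       - alphabar / alpha| <= eps.
Proof.
move=> a1 b01 dual eps0; have /andP[b0 b1] := b01; have ba := lt_trans b1 a1.
have a0 := lt_trans b0 ba.
have e2 : 0 < eps / 2 by rewrite divr_gt0.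
(* Chosen so that [expR eta = 1 + eps / 2]; also [eta <= eps / 2], which serves the lower bound. *)
pose eta := ln (1 + eps / 2).
have eta0 : 0 < eta by rewrite /eta ln_gt0 // ltrDl.
have expeta : expR eta = 1 + eps / 2 by rewrite lnK // posrE addr_gt0.
have eta_le : eta <= eps / 2.
  by have := expR_ge1Dx eta; rewrite expeta lerD2l.
have [g g0 hg] := subcritical_rate b01.
have b0' : 0 < alphabar^-1 by rewrite invr_gt0.
have [K0 hK0] := expR_decay b0' g0 e2.
exists K0 => K hK.
have k0 : (0 : R) <= K%:R by [].
have eta2 : 0 < eta / 2 by rewrite divr_gt0.
have [D1 hD1] := eventually_div alphabar (mulr_ge0 k0 (sqr_ge0 alphabar)) eta2.
have [D2 hD2] := eventually_div 0 (mulr_ge0 (sqr_ge0 K%:R) (ltW a0)) eta2.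
have [D3 hD3] := eventually_div alpha (mulr_ge0 k0 (sqr_ge0 alpha)) eta0.
have [D4 hD4] := eventually_div 1 ler01 g0.
exists (Num.max (Num.max D1 D2) (Num.max D3 D4)) => T e d esym reg.
rewrite !ge_max => /andP[/andP[/hD1[_ h1] /hD2[_ h2]] /andP[/hD3[aD h3] /hD4[D1' h4]]] v.
rewrite subr0 in h2; rewrite div1r in h4.
have D0 : 0 < d%:R :> R by apply: lt_trans D1'.
have Db0 : 0 <= alphabar / d%:R <= 1.
  by rewrite divr_ge0 ?(ltW b0) //= ler_pdivrMr // mul1r ltW // (lt_trans b1).
pose Q := fun k => (k < K)%N.
set P := expect _ _ _; pose P' := expect (edges e) (alphabar / d%:R) (fun F => (Q #|component F v|)%:R).
have P'1 : P' <= 1 by apply: (@expect_pred_le1 _ _ _ _ (fun F => Q _)).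
have P'0 : 1 - eps / 2 <= P'.
  have := subcritical_tail esym reg v K%:R b01 hg (ltW g0) D1' h4.
  move=> /le_trans/(_ (hK0 K hK)) h.
  have : P' + expect (edges e) (alphabar / d%:R) (fun F => (K%:R <= #|component F v|%:R :> R)%R%:R) = 1.
    rewrite -expectD -[RHS](expect_cst (edges e) (alphabar / d%:R) 1).
    apply: eq_expect => F _; rewrite ler_nat /Q.
    by case: leqP; rewrite /= ?addr0 ?add0r.
  lra.
have up : P <= alphabar / alpha * expR eta * P'.
  apply: expect_component_le => S vS SK; apply: (dual_component_le esym reg b0 ba aD dual _ vS (ltnW SK)).
  lra.
have lo : alphabar / alpha * expR (- eta) * P' <= P.
  by apply: expect_component_ge => S vS SK; apply: (dual_component_ge esym reg b0 ba aD dual h3 vS (ltnW SK)).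
have q0 : 0 < alphabar / alpha by rewrite divr_gt0.
have q1 : alphabar / alpha <= 1 by rewrite ler_pdivrMr // mul1r ltW.
have up' : alphabar / alpha * expR eta * P' <= alphabar / alpha + eps / 2.
  apply: le_trans (_ : alphabar / alpha * expR eta * 1 <= _).
    by rewrite ler_wpM2l // mulr_ge0 ?expR_ge0 ?(ltW q0).
  rewrite mulr1 expeta mulrDr mulr1 lerD2l ler_piMl // ltW //.
have em : 1 - eta <= expR (- eta) by apply: expR_ge1Dx.
have lo' : alphabar / alpha * (1 - eps) <= alphabar / alpha * expR (- eta) * P'.
  rewrite -(mulrA (alphabar / alpha)); apply: ler_wpM2l; first exact: ltW.
  have em1 : expR (- eta) <= 1 by rewrite -expR0 ler_expR oppr_le0 ltW.
  have : expR (- eta) * (1 - P') <= 1 * (1 - P') by rewrite ler_wpM2r // subr_ge0.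
  lra.
have : alphabar / alpha * eps <= eps by rewrite ler_piMl // ltW.
rewrite ler_norml => h; apply/andP; split; lra.
Qed.

End Density.

(** * Phase transition in pseudorandom graphs *)

Section PhaseTransition.
Variable R : realType.
Implicit Types (alpha alphabar eps eta C : R).

(** Union bound: [f] will be a sum of failure indicators and counts. *)
Lemma expect_one_sub (T : finType) (e : rel T) (p : R) (f : {set {set T}} -> R)
    (A : pred {set {set T}}) (m : R) : 0 <= p <= 1 ->
  (forall F : {set {set T}}, F \subset edges e -> 1 - f F <= (A F)%:R) -> expect (edges e) p f <= m ->
  1 - m <= prob_subgraph e p A.
Proof.
move=> p01 fA hm; rewrite prob_subgraphE.
apply: le_trans (_ : expect (edges e) p (fun F => 1 + (-1) * f F) <= _).
  by rewrite expectD expectZ expect_cst mulN1r lerD2l lerN2.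
by apply: le_expect => // F Fe; rewrite mulN1r fA.
Qed.

(** This fixes the constant [2 / g] in front of the logarithm: the tail becomes [N ^ -2], and a
    union over [N] vertices still leaves [1 / N]. *)
Lemma expR_ln_bound (g N : R) : 0 < g -> 0 < N -> expR (- (g * (2 / g * ln N))) = N^-1 * N^-1.
Proof.
move=> g0 N0; have -> : - (g * (2 / g * ln N)) = - ln N + - ln N.
  by field; rewrite gt_eqF.
by rewrite expRD expRN lnK ?posrE.
Qed.

Lemma subcritical_phase alpha : 0 < alpha < 1 ->
  exists2 C : R, 0 < C & forall eta : R, 0 < eta -> exists D0 : R,
  forall (T : finType) (e : rel T) (d : nat) (kappa : R), pseudorandom e d kappa ->
    D0 <= d%:R ->
    1 - eta <= prob_subgraph e (alpha / d%:R) (fun F =>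
      [forall K in components F, #|K|%:R <= C * ln (#|T|%:R)]).
Proof.
move=> a01; have /andP[a0 a1] := a01; have [g g0 hg] := subcritical_rate a01.
exists (2 / g); first by rewrite divr_gt0.
move=> eta e0; have [D1 hD1] := eventually_div 1 ler01 g0.
have c0 : 0 <= alpha^-1 by rewrite invr_ge0 ltW.
have [D2 hD2] := eventually_div 0 c0 e0.
exists (Num.max D1 D2) => T e d kappa [esym reg dT _].
rewrite ge_max => /andP[/hD1[D1' h4] /hD2[_ h2]].
rewrite div1r in h4; rewrite subr0 in h2.
have D0 : 0 < d%:R :> R by apply: lt_trans D1'.
have N0 : 0 < #|T|%:R :> R by apply: lt_le_trans D0 _; rewrite ler_nat.
have p01 : 0 <= alpha / d%:R <= 1.
  by rewrite divr_ge0 ?(ltW a0) //= ler_pdivrMr // mul1r ltW // (lt_trans a1).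
set t : R := 2 / g * ln #|T|%:R.
apply: (@expect_one_sub _ _ _ (fun F => \sum_(v : T) (t <= #|component F v|%:R)%R%:R)) => //.
  move=> F _; case: (boolP [forall K in _, _]) => [_|]; first by rewrite gerBl sumr_ge0.
  rewrite negb_forall => /existsP[S]; rewrite negb_imply => /andP[/componentsP[v ->]].
  rewrite -ltNge => hv; rewrite subr_le0 (bigD1 v) //= (ltW hv) lerDl sumr_ge0 //.
rewrite expect_sum.
apply: le_trans (_ : \sum_(v : T) alpha^-1 * (#|T|%:R^-1 * #|T|%:R^-1) <= _).
  apply: ler_sum => v _; rewrite -(@expR_ln_bound g) //.
  exact: (subcritical_tail esym reg v t a01 hg (ltW g0) D1' h4).
rewrite sumr_const -[leLHS]mulr_natl.
have -> : #|T|%:R * (alpha^-1 * (#|T|%:R^-1 * #|T|%:R^-1)) = alpha^-1 / #|T|%:R.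
  by field; rewrite !gt_eqF.
apply: le_trans h2; rewrite ler_wpM2l // lef_pV2 ?posrE // ler_nat //.
Qed.

Lemma gap_constants (alpha x0 : R) : 0 < x0 < 1 -> 1 < alpha * (1 - x0) ->
  exists beta g kappa0 D0 : R,
  [/\ 0 < beta < alpha, 1 <= alpha / beta, 0 < g, 0 < kappa0 &
    forall D kappa, D0 <= D -> kappa <= kappa0 ->
    [/\ 1 < D, alpha < D, 0 <= alpha - beta - beta ^+ 2 / (D - beta) &
      ln (alpha / beta) + g <= (1 - x0 - kappa) * (alpha - beta - beta ^+ 2 / (D - beta))]].
Proof.
move=> /andP[x00 x01] u1; set y : R := 1 - x0 in u1 *; have y0 : 0 < y by rewrite /y; lra.
have y1 : y < 1 by rewrite /y; lra.
have a0 : 0 < alpha by rewrite -(pmulr_lgt0 _ y0); lra.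
(* This [beta] maximises [y * (alpha - beta) - ln (alpha / beta)], with value [u - 1 - ln u > 0].
   One third of it becomes [g]; the other two absorb the errors from [beta ^+ 2 / (D - beta)] and
   from [kappa]. *)
pose beta : R := y^-1; pose u := alpha * y; pose g := (u - 1 - ln u) / 3.
have abE : alpha / beta = u by rewrite invrK.
have b0 : 0 < beta by rewrite invr_gt0.
have ba : beta < alpha by rewrite -(ltr_pM2r y0) mulVf ?gt_eqF.
have g0 : 0 < g.
  have u0 : 0 < u by apply: lt_trans u1.
  have : ln u < u - 1 by apply: lnx_lt; rewrite ?gt_eqF.
  by rewrite /g; lra.
pose s0 := Num.min g (alpha - beta).
have s00 : 0 < s0 by rewrite lt_min g0 subr_gt0.
have [D1 hD1] := eventually_div beta (sqr_ge0 beta) s00.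
exists beta, g, (g / alpha), (Num.max D1 (alpha + 1)); split=> //.
- by rewrite b0.
- by rewrite abE ltW.
- by rewrite divr_gt0.
move=> D kappa; rewrite ge_max => /andP[/hD1[bD]]; rewrite le_min => /andP[h1 h2] aD hk.
have a1 : 1 < alpha by apply: lt_trans u1 _; rewrite gtr_pMr.
split; [lra|lra|by rewrite subr_ge0|].
set s := beta ^+ 2 / (D - beta) in h1 h2 *.
have s1 : 0 <= s by rewrite divr_ge0 ?sqr_ge0 // subr_ge0 ltW.
rewrite abE; have yb : y * (alpha - beta) = u - 1.
  by rewrite mulrBr mulfV ?gt_eqF // mulrC.
have k1 : kappa * (alpha - beta - s) <= g.
  apply: le_trans (_ : g / alpha * (alpha - beta - s) <= _).
    by rewrite ler_wpM2r // subr_ge0.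
  by rewrite mulrAC ler_pdivrMr // ler_wpM2l ?(ltW g0) //; lra.
have ys : y * s <= g by apply: le_trans h1; rewrite ler_piMl // ltW.
have -> : (y - kappa) * (alpha - beta - s) = u - 1 - y * s - kappa * (alpha - beta - s).
  by rewrite -yb; ring.
have g3 : 3 * g = u - 1 - ln u by rewrite /g mulrC divfK.
lra.
Qed.

End PhaseTransition.

Section Supercritical.
Variable R : realType.

Lemma expect_nb_small (T : finType) (e : rel T) (p : R) K :
  expect (edges e) p (fun F => (nb_small K F)%:R) =
  \sum_(v : T) expect (edges e) p (fun F => (#|component F v| < K)%N%:R).
Proof.
rewrite -expect_sum; apply: eq_expect => F _.
rewrite /nb_small -sum1dep_card natr_sum big_mkcond; apply: eq_bigr => v _.
by case: ifP.
Qed.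

(** Chebyshev with differences [2 * K] over at most [#|T| * d] edges: at [p = alpha / d] the
    variance is linear in [#|T|], so linear deviations are unlikely. *)
Lemma nb_small_concentration (T : finType) (e : rel T) (d : nat) (p t : R) K :
  symmetric e -> (forall x, degree e x = d) -> 0 <= p <= 1 -> 0 < t ->
  expect (edges e) p (fun F => (t <= `|(nb_small K F)%:R
     - expect (edges e) p (fun F => (nb_small K F)%:R)|)%R%:R)
  <= #|T|%:R * d%:R * p * (2 * K%:R) ^+ 2 / t ^+ 2.
Proof.
move=> esym reg p01 t0.
apply: le_trans (@expect_chebyshev _ _ (edges e) p (fun F => (nb_small K F)%:R) (2 * K%:R) t p01 t0 _) _.
  move=> F _ /edgesP[x [y [_ ->]]] _; have /andP[h1 h2] := nb_small_add_edge K F x y.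
  rewrite -(ler_nat R) in h1; rewrite -(ler_nat R) natrD natrM in h2.
  by rewrite distrC ger0_norm ?subr_ge0 // lerBlDl.
rewrite ler_wpM2r ?invr_ge0 ?sqr_ge0 // ler_wpM2r ?sqr_ge0 //.
rewrite ler_wpM2r //; first by case/andP: p01.
by rewrite -natrM ler_nat; apply: card_edges.
Qed.

(** Here [l], [s], [m] count vertices in large, small and intermediate components, [Em] is the mean
    of [s], and [c] its predicted value. Since [s] is within [2 * e] of [c] and [0 <= m < e], [l]
    lies between [th - 3 * e] and [th + 2 * e]. *)
Lemma large_card_bounds (l s m Em c n th x e B : R) :
  l + s + m = n -> 0 <= m -> m < e -> `|s - Em| < e -> `|Em - c| <= e ->
  th = n - c -> 3 * e <= B -> 2 * e <= 2 * x - th -> 6 * e <= th -> 0 < e ->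
  [/\ 0 < l, l <= 2 * x & `|l - th| <= B].
Proof.
rewrite ltr_norml !ler_norml => h1 h2 h3 /andP[h4 h5] /andP[h6 h7] h8 h9 h10 h11 h12.
by split; [lra|lra|apply/andP; split; lra].
Qed.

Variables alpha alphabar : R.
Hypotheses (alpha_gt1 : 1 < alpha) (neq : alphabar != alpha).
Hypothesis dual : alphabar * expR (- alphabar) = alpha * expR (- alpha).

Lemma supercritical_phase :
  exists2 C : R, 0 < C & forall eps eta : R, 0 < eps -> 0 < eta -> exists kappa0 D0 : R,
  0 < kappa0 /\
  forall (T : finType) (e : rel T) (d : nat) (kappa : R), pseudorandom e d kappa ->
    D0 <= d%:R -> kappa <= kappa0 ->
    1 - eta <= prob_subgraph e (alpha / d%:R) (fun F =>
      [exists K in components F,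
        (`| #|K|%:R - (1 - alphabar / alpha) * #|T|%:R |
           <= eps * ((1 - alphabar / alpha) * #|T|%:R))
        && [forall K' in components F,
             (K' != K) ==> (#|K'|%:R <= C * ln (#|T|%:R))]]).
Proof.
have b0 := dual_gt0 alpha_gt1 dual; have b1 := dual_lt1 alpha_gt1 neq dual.
have a0 : 0 < alpha by apply: lt_trans alpha_gt1.
have sum2 := dual_sum alpha_gt1 neq dual; have lnd := dual_ln alpha_gt1 dual.
pose th : R := 1 - alphabar / alpha.
have th0 : 0 < th by rewrite subr_gt0 ltr_pdivrMr // mul1r (lt_trans b1).
(* Equivalent to [alpha + alphabar > 2]. *)
have th2 : th / 2 < 1 - alpha^-1.
  rewrite /th -(ltr_pM2r a0) -subr_gt0.
  have -> : (1 - alpha^-1) * alpha - (1 - alphabar / alpha) / 2 * alpha = (alpha + alphabar - 2) / 2.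
    by field; rewrite gt_eqF.
  by rewrite divr_gt0 // subr_gt0.
(* Components larger than x0 N cannot coexist, as 2 x0 exceeds the density th
   of the vertices in large components. *)
pose x0 : R := (th / 2 + (1 - alpha^-1)) / 2.
have ai : 0 < alpha^-1 by rewrite invr_gt0.
have x01 : 0 < x0 < 1 by rewrite /x0; apply/andP; split; lra.
have x0a : 1 < alpha * (1 - x0).
  rewrite -[X in X < _](mulfV (lt0r_neq0 a0)) ltr_pM2l // /x0; lra.
have thx : th < 2 * x0 by rewrite /x0; lra.
have [beta [g [kappa0 [D1 [ba ab1 g0 k0 gap]]]]] := gap_constants x01 x0a.
have b01 : 0 < alphabar < 1 by rewrite b0.
exists (2 / g); first by rewrite divr_gt0.
move=> eps eta eps0 eta0.
(* The three bounds serve, in order, the accuracy [eps], the uniqueness of the large component and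
   its existence. *)
pose e1 : R := Num.min (Num.min (eps * th / 3) ((2 * x0 - th) / 2)) (th / 6).
have e10 : 0 < e1.
  by rewrite !lt_min !divr_gt0 ?mulr_gt0 //; lra.
have e1a : 3 * e1 <= eps * th.
  by rewrite mulrC -ler_pdivlMr // !ge_min lexx.
have e1b : 2 * e1 <= 2 * x0 - th.
  by rewrite mulrC -ler_pdivlMr // !ge_min lexx orbT.
have e1c : 6 * e1 <= th.
  by rewrite mulrC -ler_pdivlMr // !ge_min lexx !orbT.
have eta3 : 0 < eta / 3 by rewrite divr_gt0.
have [K1 hK1] := small_component_density alpha_gt1 b01 lnd e10.
have [K2 hK2] := expR_decay (ltr01 : 0 < 1 :> R) g0 (mulr_gt0 eta3 e10).
(* [K1] brings the density of small components within [e1] of [alphabar / alpha]; [K2] makes the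
   expected number of intermediate vertices small enough for Markov's inequality. *)
pose K := maxn K1 K2.
have [D2 hD2] := hK1 K (leq_maxl _ _).
have {}hK2 := hK2 K (leq_maxr _ _); rewrite mul1r in hK2.
have [D3 hD3] := eventually_div 0 ler01 eta3.
have x00 : 0 < x0 by case/andP: x01.
have [D4 hD4] := eventually_div 0 (ler0n R K) x00.
have c0 : 0 <= alpha * (2 * K%:R) ^+ 2 / e1 ^+ 2.
  by apply: divr_ge0; rewrite ?sqr_ge0 //; apply: mulr_ge0; rewrite ?sqr_ge0 ?ltW.
have [D5 hD5] := eventually_div 0 c0 eta3.
exists kappa0, (Num.max D1 (Num.max (Num.max D2 D3) (Num.max D4 D5))); split=> //.
move=> T e d kappa [esym reg dT mix]; rewrite !ge_max.
move=> /and3P[h1 /andP[h2 /hD3[_ h3]] /andP[/hD4[_ h4] /hD5[_ h5]]] hk.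
rewrite !subr0 in h3 h4 h5.
have [D1' aD w0 hw] := gap _ _ h1 hk; have {}hD2 := hD2 T e d esym reg h2.
have D0 : 0 < d%:R :> R by apply: lt_trans D1'.
have dN : d%:R <= #|T|%:R :> R by rewrite ler_nat.
have N0 : 0 < #|T|%:R :> R by apply: lt_le_trans D0 _.
have p01 : 0 <= alpha / d%:R <= 1.
  by rewrite divr_ge0 ?(ltW a0) //= ler_pdivrMr // mul1r ltW.
set N : R := #|T|%:R in dN N0 *; set p : R := alpha / d%:R in p01 *.
set t : R := 2 / g * ln N.
have KN : K%:R <= x0 * N.
  rewrite ler_pdivrMr // in h4; apply: le_trans h4 _; rewrite ler_wpM2l ?(ltW x00) //.
(* Three failures, each of expectation at most [eta / 3]: [A1] counts vertices in components between
   [t] and [x0 * N], [A2] signals too many vertices in components between [K] and [x0 * N], and [A3]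
   a deviation of [nb_small]. *)
pose mid (F : {set {set T}}) : R := \sum_(v : T) ((K%:R <= #|component F v|%:R :> R) && (#|component F v|%:R <= x0 * N))%R%:R.
pose A1 (F : {set {set T}}) : R := \sum_(v : T) ((t <= #|component F v|%:R) && (#|component F v|%:R <= x0 * N))%R%:R.
pose A2 (F : {set {set T}}) : R := (e1 * N <= mid F)%R%:R.
pose Em := expect (edges e) p (fun F => (nb_small K F)%:R).
pose A3 (F : {set {set T}}) : R := (e1 * N <= `|(nb_small K F)%:R - Em|)%R%:R.
have tail v s := @gap_tail R T e d reg alpha beta x0 kappa g v s ba (ltW g0) aD mix ab1 w0 hw.
apply: (@expect_one_sub _ _ _ _ (fun F => A1 F + (A2 F + A3 F))) => //; last first.
  have -> : eta = eta / 3 + (eta / 3 + eta / 3) by lra.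
  rewrite !expectD; apply: lerD; last apply: lerD.
  - rewrite expect_sum; apply: le_trans (_ : \sum_(v : T) N^-1 * N^-1 <= _).
      by apply: ler_sum => v _; rewrite -(@expR_ln_bound _ g) //; apply: tail.
    rewrite sumr_const -[leLHS]mulr_natl mulrA mulfV ?gt_eqF // mul1r.
    by apply: le_trans h3; rewrite div1r lef_pV2 ?posrE.
  - apply: le_trans (expect_markov p01 (mulr_gt0 e10 N0) _) _.
      by move=> F _; apply: sumr_ge0.
    rewrite ler_pdivrMr ?mulr_gt0 // expect_sum.
    apply: le_trans (_ : \sum_(v : T) eta / 3 * e1 <= _).
      by apply: ler_sum => v _; apply: le_trans (tail v K%:R) hK2.
    by rewrite sumr_const -[leLHS]mulr_natl mulrC mulrA.
  - apply: le_trans (@nb_small_concentration T e d p (e1 * N) K esym reg p01 (mulr_gt0 e10 N0)) _.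
    have -> : #|T|%:R * d%:R * p * (2 * K%:R) ^+ 2 / (e1 * N) ^+ 2 =
        alpha * (2 * K%:R) ^+ 2 / e1 ^+ 2 / N.
      by rewrite /p /N; field; rewrite !gt_eqF.
    by apply: le_trans h5; rewrite ler_wpM2l // lef_pV2 ?posrE.
move=> F _.
have A1_ge0 : 0 <= A1 F by apply: sumr_ge0.
have A2_ge0 : 0 <= A2 F by [].
have A3_ge0 : 0 <= A3 F by [].
(* If a failure occurs, the left side is at most 0; afterwards none occurs and the argument is
   deterministic. *)
have [big1|big1] := boolP [exists v, (t < #|component F v|%:R) && (#|component F v|%:R <= x0 * N)].
  apply: (@le_trans _ _ 0); last by [].
  case/existsP: big1 => v /andP[v1 v2].
  have : 1 <= A1 F by rewrite /A1 (bigD1 v) //= (ltW v1) v2 lerDl sumr_ge0.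
  lra.
have [m2|m2] := boolP (e1 * N <= mid F).
  apply: (@le_trans _ _ 0); last by [].
  have : A2 F = 1 by rewrite /A2 m2.
  lra.
have [m3|m3] := boolP (e1 * N <= `|(nb_small K F)%:R - Em|).
  apply: (@le_trans _ _ 0); last by [].
  have : A3 F = 1 by rewrite /A3 m3.
  lra.
apply: (@le_trans _ _ 1); first lra.
rewrite -ltNge in m2; rewrite -ltNge in m3.
have Emb : `|Em - alphabar / alpha * N| <= e1 * N.
  rewrite /Em expect_nb_small.
  have -> : alphabar / alpha * N = \sum_(v : T) alphabar / alpha.
    by rewrite sumr_const -[RHS]mulr_natl mulrC.
  rewrite -sumrB; apply: le_trans (ler_norm_sum _ _ _) _.
  apply: le_trans (_ : \sum_(v : T) e1 <= _); first by apply: ler_sum => v _; apply: hD2.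
  by rewrite sumr_const -[leLHS]mulr_natl mulrC.
have := @card_large T R (x0 * N) F K KN.
set L := [set v | _]; set M := [set v | _] => hL.
have Mmid : #|M|%:R = mid F.
  rewrite /M /mid -sum1dep_card natr_sum big_mkcond; apply: eq_bigr => v _.
  by rewrite ler_nat; case: ifP.
have {}hL : #|L|%:R + (nb_small K F)%:R + mid F = N by rewrite -Mmid -!natrD hL.
have mid0 : 0 <= mid F by apply: sumr_ge0.
have thN : th * N = N - alphabar / alpha * N by rewrite mulrBl mul1r.
have thN0 : 0 < th * N by rewrite mulr_gt0.
have f1 : 3 * (e1 * N) <= eps * (th * N) by rewrite !mulrA ler_wpM2r // ltW.
have f2 : 2 * (e1 * N) <= 2 * (x0 * N) - th * N.
  by have := ler_wpM2r (ltW N0) e1b; rewrite mulrBl -!mulrA.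
have f3 : 6 * (e1 * N) <= th * N by rewrite mulrA ler_wpM2r // ltW.
have e1N : 0 < e1 * N by rewrite mulr_gt0.
have [L0 L2 Lb] := large_card_bounds hL mid0 m2 m3 Emb thN f1 f2 f3 e1N.
rewrite ltr0n in L0.
have gapF v : ~~ (t < #|component F v|%:R <= x0 * N).
  by apply: contra big1 => hv; apply/existsP; exists v.
have [LF hothers] := unique_large_component gapF L0 L2.
rewrite (_ : [exists K in _, _] = true) //; apply/existsP; exists L.
rewrite LF /= -/th -/N Lb /=.
by apply/forallP => S; apply/implyP => SF; apply/implyP => SL; apply: hothers.
Qed.

End Supercritical.

(** * The limit n -> oo *)

Section Asymptotics.
Variable R : realType.

(** Makes the degree of the Kneser graph at least [n - r], hence unbounded. *)
Lemma leq_bin m k : (0 < k < m)%N -> (m <= 'C(m, k))%N.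
Proof.
elim: m k => [|m IH] [|k] // /andP[_]; rewrite ltnS leq_eqVlt => /orP[/eqP <-|km].
  by rewrite binSn.
rewrite binS -addn1; apply: leq_add; first by apply: IH.
by rewrite bin_gt0 ltnW // ltnW.
Qed.

Lemma johnson_pseudorandom n r : (0 < r)%N -> (r + r <= n)%N ->
  pseudorandom (johnson n r 0) 'C(n - r, r) (r%:R / (n - r)%:R : R).
Proof.
move=> r0 rn; split=> [|x||S]; first exact: johnson_sym.
- exact: degree_johnson.
- by rewrite card_johnson_vertex leq_bin2l // leq_subr.
- exact: johnson_mixing.
Qed.

Lemma regular_degree_johnson n r : (0 < r)%N -> (r <= n)%N ->
  regular_degree (johnson n r 0) = 'C(n - r, r).
Proof.
move=> r0 rn; apply/eqP; rewrite eqn_leq; apply/andP; split.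
  by apply/bigmax_leqP => x _; rewrite degree_johnson.
have /card_gt0P[x _] : (0 < #|johnson_vertex n r|)%N by rewrite card_johnson_vertex bin_gt0.
by rewrite -(degree_johnson x r0); apply: leq_bigmax.
Qed.

Lemma johnson_near (r : nat -> nat) (kappa0 D0 : R) : (forall n, (1 <= r n)%N) ->
  ((n%:R / (r n)%:R : R) @[n --> \oo] --> +oo)%classic -> 0 < kappa0 ->
  (\forall n \near \oo, [/\ (r n + r n <= n)%N, D0 <= 'C(n - r n, r n)%:R :> R &
    (r n)%:R / (n - r n)%:R <= kappa0])%classic.
Proof.
move=> r1 nr k0; pose M : R := Num.max (1 + kappa0^-1) (Num.max (2 * D0) 3).
near=> n; have hM : M <= n%:R / (r n)%:R by near: n; apply: (cvgryPge _).1 nr M.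
have r0 : 0 < (r n)%:R :> R by rewrite ltr0n.
move: hM; rewrite /M !ge_max !ler_pdivlMr // => /and3P[hk hD h3].
have r3 : (3 * r n <= n)%N by rewrite -(ler_nat R) natrM.
have rn : (r n + r n <= n)%N by apply: leq_trans r3; rewrite mulSn mul2n -addnn leq_addl.
have rn' : (r n <= n)%N by apply: leq_trans rn; apply: leq_addr.
have nrE : (n - r n)%:R = n%:R - (r n)%:R :> R by rewrite natrB.
split=> //.
  apply: le_trans (_ : (n - r n)%:R <= _).
    have r1' : 1 <= (r n)%:R :> R by rewrite ler1n.
    have h3' : 3 * (r n)%:R <= n%:R :> R by [].
    rewrite nrE; have [D0' | /ltW D0'] := leP D0 0; first by lra.
    have : 2 * D0 <= 2 * D0 * (r n)%:R by rewrite ler_peMr // mulr_ge0.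
    lra.
  rewrite ler_nat; apply: leq_bin; rewrite r1 /= ltn_subRL.
  by apply: leq_trans r3; rewrite !mulSn mul0n addn0 addnA -addn1 leq_add2l.
rewrite nrE ler_pdivrMr; last by lra.
rewrite mulrDl mul1r in hk; have := ler_wpM2l (ltW k0) (_ : (r n)%:R / kappa0 <= n%:R - (r n)%:R).
rewrite mulrCA mulfV ?mulr1 ?gt_eqF // => -> //; rewrite mulrC; lra.
Unshelve. all: by end_near.
Qed.

Lemma whpP (P : nat -> R) : (forall eta : R, 0 < eta -> \forall n \near \oo, 1 - eta <= P n <= 1)%classic ->
  whp P.
Proof.
move=> h; apply/cvgrPdist_le => eta e0; have := h _ e0; apply: filterS => n /andP[h1 h2].
by rewrite ger0_norm ?subr_ge0 // lerBlDr -lerBlDl.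
Qed.

(** Diagonal argument: statements that hold eventually for each fixed [eps] are merged into one with
    an error tending to 0, which expresses [1 + o(1)]. *)
Lemma diagonal_rate (P : R -> nat -> R) :
  (forall eps eta : R, 0 < eps -> 0 < eta -> \forall n \near \oo, 1 - eta <= P eps n <= 1)%classic ->
  exists2 delta : nat -> R, (delta n @[n --> \oo] --> 0)%classic &
    (forall eta : R, 0 < eta -> \forall n \near \oo, 1 - eta <= P (delta n) n <= 1)%classic.
Proof.
move=> hP; pose u (m : nat) : R := m.+1%:R^-1.
have u0 m : 0 < u m by rewrite invr_gt0.
have /choice[N hN] : forall m, exists N0, forall n, (N0 <= n)%N -> 1 - u m <= P (u m) n <= 1.
  move=> m; have [N0 _ h] := hP _ _ (u0 m) (u0 m); exists N0 => n hn; exact: h.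
(* The best accuracy level whose threshold has been passed by time [n]. From [N 0] on some level
   qualifies, so the maximum is attained; before that it defaults to 0. *)
pose k n := (\max_(m < n.+1 | N m <= n) m)%N.
have kN n : (N 0 <= n)%N -> (N (k n) <= n)%N.
  move=> n0; have [|i Ni ki] := @eq_bigmax_cond _ [pred m : 'I_n.+1 | (N m <= n)%N] (fun m => m : nat).
    by apply/card_gt0P; exists ord0; rewrite inE.
  have -> : k n = i by rewrite -ki; apply: eq_bigl => m; rewrite inE.
  by rewrite inE in Ni.
have klarge m : (\forall n \near \oo, m <= k n)%classic%N.
  exists (maxn m (N m)) => // n /=; rewrite geq_max => /andP[mn Nn].
  have mn' : (m < n.+1)%N by [].
  exact: (@leq_bigmax_cond _ (fun i : 'I_n.+1 => (N i <= n)%N) (fun i => i : nat) (Ordinal mn') Nn).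
have u_small eta : 0 < eta -> (\forall n \near \oo, u (k n) <= eta)%classic.
  move=> e0; have := archi_boundP (ltW (_ : 0 < eta^-1)); rewrite invr_gt0 => /(_ e0).
  set m := Num.bound _ => hm; have := klarge m; apply: filterS => n mk.
  rewrite /u -[leRHS]invrK lef_pV2 ?posrE ?invr_gt0 //; apply: le_trans (ltW hm) _.
  by rewrite ler_nat leqW.
exists (fun n => u (k n)).
  apply/cvgrPdist_le => eta e0; have := u_small _ e0; apply: filterS => n.
  by rewrite sub0r normrN ger0_norm // ltW.
move=> eta e0; near=> n.
have /hN/andP[h1 h2] : (N (k n) <= n)%N by apply: kN; near: n; exists (N 0%N).
rewrite h2 andbT; apply: le_trans h1; rewrite lerD2l lerN2.
by near: n; apply: u_small.
Unshelve. all: by end_near.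
Qed.

Lemma prob_subgraph_le1 (T : finType) (e : rel T) (p : R) (A : pred {set {set T}}) :
  0 <= p <= 1 -> prob_subgraph e p A <= 1.
Proof. by move=> p01; rewrite prob_subgraphE; apply: expect_pred_le1. Qed.

End Asymptotics.

Local Open Scope classical_set_scope.
Local Open Scope ring_scope.

Theorem theorem3p16 (R : realType) (r : nat -> nat)
    (r_ge1 : forall n, (1 <= r n)%N)
    (n_gg_r : (n%:R / (r n)%:R : R) @[n --> \oo] --> +oo) :
  let G n := johnson n (r n) 0 in
  let d n : R := (regular_degree (G n))%:R in
  let N n : R := 'C(n, r n)%:R in
  (forall alpha : R, 0 < alpha < 1 ->
     exists2 C : R, 0 < C &
       whp (fun n => prob_subgraph (G n) (alpha / d n) (fun F =>
         [forall K in components F, #|K|%:R <= C * ln (N n)])))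
  /\
  (forall alpha alphabar : R, 1 < alpha ->
     alphabar != alpha ->
     alphabar * expR (- alphabar) = alpha * expR (- alpha) ->
     exists2 C : R, 0 < C &
     exists2 delta : nat -> R, delta n @[n --> \oo] --> 0 &
       whp (fun n => prob_subgraph (G n) (alpha / d n) (fun F =>
         [exists K in components F,
           (`| #|K|%:R - (1 - alphabar / alpha) * N n |
              <= delta n * ((1 - alphabar / alpha) * N n))
           && [forall K' in components F,
                 (K' != K) ==> (#|K'|%:R <= C * ln (N n))]]))).
Proof.
move=> G d N.
(* The degree is defined as a maximum, so reading it off needs a vertex; the condition holds for all
   large [n]. *)
have dE n : (r n + r n <= n)%N -> d n = 'C(n - r n, r n)%:R.
  by move=> rn; rewrite /d regular_degree_johnson // (leq_trans _ rn) ?leq_addl.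
have NE n : N n = #|johnson_vertex n (r n)|%:R by rewrite /N card_johnson_vertex.
have ratio01 (D alpha : R) : 0 < alpha -> Num.max 1 alpha <= D -> 0 <= alpha / D <= 1.
  rewrite ge_max => a0 /andP[D1 aD]; have D0 : 0 < D by apply: lt_le_trans D1.
  by rewrite divr_ge0 ?(ltW a0) ?(ltW D0) //= ler_pdivrMr // mul1r.
split=> [alpha a01|alpha alphabar a1 neq dual].
  have [C C0 hC] := subcritical_phase a01; exists C => //.
  apply: whpP => eta /hC[D0 hD].
  have near_n := johnson_near (Num.max D0 (Num.max 1 alpha)) r_ge1 n_gg_r ltr01.
  near=> n; have [rn] : [/\ (r n + r n <= n)%N,
      Num.max D0 (Num.max 1 alpha) <= 'C(n - r n, r n)%:R :> R &
      (r n)%:R / (n - r n)%:R <= 1 :> R] by near: n.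
  rewrite ge_max => /andP[D0n an] _.
  have := hD _ _ _ _ (johnson_pseudorandom R (r_ge1 n) rn) D0n.
  rewrite /= (dE n rn) NE => ->; apply: prob_subgraph_le1.
  by apply: ratio01 an; case/andP: a01.
have [C C0 hC] := supercritical_phase a1 neq dual; exists C => //.
(* The accuracy is left as a parameter so that [diagonal_rate] can replace it by a sequence; [C] is
   already fixed. *)
pose P (eps : R) n := prob_subgraph (G n) (alpha / d n) (fun F =>
         [exists K in components F,
           (`| #|K|%:R - (1 - alphabar / alpha) * N n |
              <= eps * ((1 - alphabar / alpha) * N n))
           && [forall K' in components F,
                 (K' != K) ==> (#|K'|%:R <= C * ln (N n))]]).
have [|delta d0 hdelta] := @diagonal_rate R P.
  move=> eps eta e0 h0; have [kappa0 [D0 [k0 hD]]] := hC _ _ e0 h0.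
  have near_n := johnson_near (Num.max D0 (Num.max 1 alpha)) r_ge1 n_gg_r k0.
  near=> n; have [rn] : [/\ (r n + r n <= n)%N,
      Num.max D0 (Num.max 1 alpha) <= 'C(n - r n, r n)%:R :> R &
      (r n)%:R / (n - r n)%:R <= kappa0] by near: n.
  rewrite ge_max => /andP[D0n an] kn.
  have := hD _ _ _ _ (johnson_pseudorandom R (r_ge1 n) rn) D0n kn.
  rewrite /P /= (dE n rn) NE => ->; apply: prob_subgraph_le1.
  by apply: ratio01 an; apply: lt_trans a1.
by exists delta => //; apply: whpP.
Unshelve. all: by end_near.
Qed.
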